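(* Let $W$ be a finite Coxeter group and $c$ a Coxeter element. An element $w\in W$ is $c$-sortable if and only if $w$ is $c$-aligned.
   Context: $W$ is a finite Coxeter group with simple generators $S$, reflections $T$, realized as a reflection group with fundamental region $R$ (the region of the Coxeter arrangement whose facet hyperplanes are those of $S$). An inversion of $w$ is $t\in T$ with $l(tw)<l(w)$, $I(w)$ the set of inversions. A parabolic subgroup is a conjugate of a subgroup generated by a subset of $S$. Its canonical generators are the simple generators of $W'$ obtained by choosing the region $R'$ of the Coxeter arrangement of $W'$ containing $R$. Two distinct reflections are adjacent if their reflecting hyperplanes both define facets of some region of the Coxeter arrangement. An orientation of $W$ is a directed graph on vertex set $T$ such that $t_1\to t_2$ implies $t_1,t_2$ are adjacent and do not commute, and such that for every irreducible (i.e. noncommutative) rank-two parabolic subgroup $W'$ the induced graph on the reflections of $W'$ is a directed cycle. A Coxeter element $c$ is an element with a reduced word that is a permutation of $S$; $s$ is initial in $c$ if it is the first letter of some reduced word for $c$. The $c$-orientation (arrows $t_1\to_c t_2$) is the member indexed by $c$ of the unique family of orientations, indexed by Coxeter elements, such that for every irreducible rank-two parabolic subgroup $W'$ and every initial letter $s$ of $c$: (i) if the canonical generators of $W'$ are $s$ and $t$ then $s\to_c t$; (ii) if $t_1\to_c t_2$ then $st_1s\to_{scs}st_2s$. An element $w$ is $c$-aligned if for every irreducible rank-two parabolic subgroup $W'$ with canonical generators $t_1,t_2$ and $t_1\to_c t_2$: if $t_2t_1t_2\in I(w)$ then $t_1\in I(w)$. $c$-sortable: fix a reduced word $a_1\cdots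 a_n$ for $c$, form $c^\infty=a_1\cdots a_n|a_1\cdots a_n|\cdots$; the $c$-sorting word of $w$ is the lexicographically first (in positions of $c^\infty$) subword of $c^\infty$ that is a reduced word for $w$; $w$ is $c$-sortable if the sequence of sets of letters between consecutive dividers is weakly decreasing under inclusion. *)

(* Defs.v *)
From HB Require Import structures.
From mathcomp Require Import all_boot all_order all_fingroup all_algebra.
From mathcomp Require Import mxrepresentation.
From mathcomp Require Import boolp classical_sets reals topology normedtype.

Set Implicit Arguments.
Unset Strict Implicit.
Unset Printing Implicit Defensive.

Import GroupScope.
Import Order.TTheory GRing.Theory Num.Theory.
Import numFieldNormedType.Exports.

Section CoxeterCombinatorics.

Variable gT : finGroupType.
Implicit Types (W P : {group gT}) (S A : {set gT}) (a : seq gT).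

(* W is presented by the generators S and the relations (s t)^m(s,t) = 1,
   where m(s,t) is the order of s t in W: the last clause is the universal
   property of this presentation, tested against arbitrary groups. *)
Definition coxeter_system W S : Prop :=
  [/\ <<S>> = W,
      forall s, s \in S -> #[s] = 2
    & forall (hT : groupType) (f : gT -> hT),
        {in S &, forall s t, (f s * f t) ^+ #[s * t] = 1} ->
        exists2 phi : gT -> hT,
          {in W &, {morph phi : x y / x * y}} & {in S, phi =1 f}].

Definition reflections W S : {set gT} := class_support S W.

Definition word_for S (w : gT) a : bool :=
  all [in S] a && (\prod_(s <- a) s == w).

(* Every w in <<S>> has a word of length < #|gT|, so that the search bound is
   harmless there. *)
Definition cox_length S (w : gT) : nat :=
  find (fun k => [exists a : k.-tuple gT, word_for S w a]) (iota 0 #|gT|).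

Definition reduced_word S (w : gT) a : bool :=
  word_for S w a && (size a == cox_length S w).

Definition inversions W S (w : gT) : {set gT} :=
  [set t in reflections W S | cox_length S (t * w) < cox_length S w].

Definition rank2_parabolic W S P : Prop :=
  exists J : {set gT}, exists2 g, g \in W &
    [/\ J \subset S, #|J| = 2 & P = <<J>> :^ g :> {set gT}].

Definition irr_rank2_parabolic W S P : Prop :=
  rank2_parabolic W S P /\ ~~ abelian P.

Definition coxeter_element S (c : gT) : Prop :=
  exists2 a, reduced_word S c a & perm_eq a (enum S).

Definition initial_letter S (c s : gT) : Prop :=
  exists a, reduced_word S c (s :: a).

(* For a word a = a_1...a_n, positions in a^oo = a_1...a_n|a_1...a_n|... are
   numbered from 0, and the k-th block consists of the positions i with
   i %/ n = k. *)
Definition letter_at a (i : nat) : gT := nth 1 a (i %% size a).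

Definition reduced_subword S a (w : gT) (p : seq nat) : Prop :=
  sorted ltn p /\ reduced_word S w [seq letter_at a i | i <- p].

Definition sorting_positions S a (w : gT) (p : seq nat) : Prop :=
  reduced_subword S a w p /\
  forall q, reduced_subword S a w q -> ((p : seqlexi nat) <= q)%O.

Definition block_letters a (p : seq nat) (k : nat) : {set gT} :=
  [set x in [seq letter_at a i | i <- p & i %/ size a == k]].

Definition sortable S a (w : gT) : Prop :=
  exists2 p, sorting_positions S a w p &
    forall k, block_letters a p k.+1 \subset block_letters a p k.

Definition directed_cycle_on (o : rel gT) A : Prop :=
  exists s : seq gT,
    [/\ uniq s, s =i A & {in A &, forall x y, o x y = (y == next s x)}].

End CoxeterCombinatorics.

Section Arrangement.

Variables (R : realType) (gT : finGroupType) (W : {group gT}) (n : nat).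
Variable rG : mx_representation R W n.
Implicit Types (A : {set gT}) (D : set 'rV[R]_n).

Definition orthogonal_reflection (M : 'M[R]_n) : Prop :=
  let dot (u v : 'rV[R]_n) := ((u *m v^T) 0 0)%R in
  exists2 e : 'rV[R]_n, (e != 0)%R &
    forall v, (v *m M = v - (2 * dot v e / dot e e) *: e)%R.

Definition mirror (t : gT) : set 'rV[R]_n := [set v | (v *m rG t = v)%R]%classic.

Definition arrangement_compl A : set 'rV[R]_n :=
  [set v | forall t, t \in A -> ~ mirror t v]%classic.

Definition region A D : Prop :=
  exists2 x, arrangement_compl A x &
    D = connected_component (arrangement_compl A) x.

(* The face of the closed region in the mirror of t has codimension one: it
   spans the mirror. *)
Definition defines_facet D (t : gT) : Prop :=
  exists2 B : 'M[R]_n,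
    forall i, (closure D `&` mirror t)%classic (row i B) &
    forall v, mirror t v -> (v <= B)%MS.

End Arrangement.

Section Orientation.

Variables (R : realType) (gT : finGroupType) (W : {group gT}) (S : {set gT}).
Variables (n : nat) (rG : mx_representation R W n) (C : set 'rV[R]_n).
Implicit Types (P : {group gT}) (o : rel gT).

Local Notation T := (reflections W S).

Definition reflection_realization : Prop :=
  [/\ mx_faithful rG,
      forall s, s \in S -> orthogonal_reflection (rG s),
      region rG T C
    & forall t, t \in T -> (defines_facet rG C t <-> t \in S)].

Definition canonical_generators P : {set gT} :=
  [set t in T :&: P | `[< exists D, [/\ region rG (T :&: P) D,
                                       (C `<=` D)%classic
                                     & defines_facet rG D t] >]].

Definition adjacent (t1 t2 : gT) : Prop :=
  t1 <> t2 /\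
  exists D, [/\ region rG T D, defines_facet rG D t1 & defines_facet rG D t2].

Definition orientation o : Prop :=
  (forall t1 t2, o t1 t2 ->
     [/\ t1 \in T, t2 \in T, adjacent t1 t2 & ~ commute t1 t2]) /\
  (forall P, irr_rank2_parabolic W S P -> directed_cycle_on o (T :&: P)).

(* The values of the family outside Coxeter elements are irrelevant. *)
Definition c_orientation_family (o : gT -> rel gT) : Prop :=
  (forall c, coxeter_element S c -> orientation (o c)) /\
  (forall c s, coxeter_element S c -> initial_letter S c s ->
     (forall P t, irr_rank2_parabolic W S P ->
        canonical_generators P = [set s; t] -> o c s t) /\
     (forall t1 t2, o c t1 t2 ->
        o (s * c * s) (s * t1 * s) (s * t2 * s))).

Definition aligned o (w : gT) : Prop :=
  forall P t1 t2, irr_rank2_parabolic W S P ->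
    canonical_generators P = [set t1; t2] -> o t1 t2 ->
    t2 * t1 * t2 \in inversions W S w -> t1 \in inversions W S w.

End Orientation.

(* Main.v *)
(* Let [B] be the Euclidean form and, for a word [a] of the Coxeter element,
   let [om] be the skew form on the span of the roots with
   [om r s = - B r s] when [r] precedes [s] in [a].  If [s] is the first letter
   of [a], then [om] is nonnegative on pairs ([s], positive root), and applying
   [s] carries [om] to the skew form of the word rotated by one letter.  Hence
   the c-orientation of the canonical generators of a rank two parabolic
   subgroup is given by the sign of [om], and alignment says: if a positive
   root [x t1 + y t2] is an inversion of [w] and [om t1 t2 > 0], then so is [t1].

   Sortability and alignment obey the same recursion on the first letter [s].
   If [s] is an inversion of [w], replace ([s a], [w]) by ([a s], [s w]);
   otherwise [w] must lie in the parabolic subgroup that omits [s].  For an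
   aligned [w] the last claim is seen as follows.  Otherwise, the parabolic part
   [x] of [w] is shorter than [w] and [x s] is an inversion of [w].  By induction
   [x] has a reduced word [s1 ... sk] whose inversions [b1, ..., bk] satisfy
   [om bi bj >= 0] for [i < j].  Since [(s1 ... si) s] is
   [(s1 ... s(i-1)) s + k bi] with [k >= 0], and [om] is positive on these two
   summands if [k > 0] (it is nonnegative by the choice of the word, and nonzero
   because the summands are not orthogonal), alignment takes us down from [x s]
   to [s] itself, which is not an inversion. *)

Require Import Defs.
From HB Require Import structures.
From mathcomp Require Import all_boot all_order all_fingroup all_algebra.
From mathcomp Require Import mxrepresentation.
From mathcomp Require Import boolp classical_sets reals topology normedtype.
From mathcomp Require Import ring lra zify.

Set Implicit Arguments.
Unset Strict Implicit.
Unset Printing Implicit Defensive.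

(** That [om] is nonzero on nonorthogonal roots cannot be read off coordinates. It is visible only
    when one of the roots is the first letter, so every root has to be rotated to the front: an
    orbit that never got there would consist of positive roots, and their sum would be a nonzero
    vector fixed by the Coxeter element. The axioms of the orientation family push arrows forward
    along the same rotation, and only forward, so comparing them with the sign of [om] uses that the
    rotation is periodic. Alignment tests one root of each plane, the reflection of [t1] by [t2],
    whereas the descent to [s] meets arbitrary pairs of positive roots. The gap closes because no
    positive root of the plane lies strictly between that reflection and [t2]. The representation
    need not be spanned by the roots, and [S] is tied to them only through facets. Simple roots are
    therefore a minimal spanning set of normals, matched with [S] afterwards; fixing the dual vector
    of [s] replaces membership in the parabolic subgroup that omits [s]. *)

Section Words.

Import GroupScope.

Variables (gT : finGroupType) (S : {set gT}).
Implicit Types (w : gT) (a b : seq gT).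

Lemma word_for_exists w : w \in <<S>> -> exists a, word_for S w a.
Proof.
case/gen_prodgP=> m [f fS ->]; exists [seq f i | i <- index_enum 'I_m].
rewrite /word_for big_map eqxx andbT.
by apply/allP=> x /mapP[i _ ->]; exact: fS.
Qed.

(** Two prefix products coincide by the pigeonhole principle, and the letters between them can be
    cut out. This makes the search bound [#|gT|] in [cox_length] sufficient. *)
Lemma word_for_shorten w a : word_for S w a -> #|gT| <= size a ->
  exists2 b, word_for S w b & size b < size a.
Proof.
move=> /andP[aS /eqP wE] le_a.
pose f (i : 'I_(size a).+1) := \prod_(s <- take i a) s.
have /injectivePn[i [j neq_ij eq_f]] : ~~ injectiveb f.
  apply/negP=> /injectiveP/leq_card; rewrite card_ord => le2.
  by have := leq_trans le2 le_a; rewrite ltnn.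
wlog lt_ij : i j neq_ij eq_f / i < j.
  move=> gen; move: (neq_ij); rewrite -val_eqE neq_ltn => /orP[|]; first exact: gen.
  by apply: gen; rewrite // eq_sym.
have le_i : i <= size a by rewrite -ltnS.
have le_j : j <= size a by rewrite -ltnS.
exists (take i a ++ drop j a).
  rewrite /word_for all_cat big_cat /= -/(f i) eq_f /f -big_cat cat_take_drop.
  rewrite wE eqxx andbT; apply/andP; split; apply/allP=> x xa.
    exact: (allP aS _ (mem_take xa)).
  exact: (allP aS _ (mem_drop xa)).
rewrite size_cat size_drop size_takel //; lia.
Qed.

Lemma cox_length_le w a : word_for S w a -> cox_length S w <= size a.
Proof.
move=> aw; rewrite leqNgt; apply/negP=> lt_a.
have := @before_find _ 0 _ (iota 0 #|gT|) _ lt_a.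
have lt_aT : size a < #|gT|.
  by apply: leq_trans lt_a _; rewrite -[X in _ <= X](size_iota 0); exact: find_size.
rewrite nth_iota // add0n => /existsP[]; exists (in_tuple a); exact: aw.
Qed.

Lemma reduced_word_exists w : w \in <<S>> -> exists a, reduced_word S w a.
Proof.
case/word_for_exists=> a; have [k] := ubnP (size a).
elim: k a => // k IHk a lt_k aw.
have [le_a|lt_a] := leqP #|gT| (size a).
  have [b bw lt_b] := word_for_shorten aw le_a.
  exact: IHk (leq_trans lt_b _) bw.
pose P k := [exists a : k.-tuple gT, word_for S w a].
have hasP : has P (iota 0 #|gT|).
  apply/hasP; exists (size a); first by rewrite mem_iota.
  by apply/existsP; exists (in_tuple a).
have := nth_find 0 hasP; rewrite has_find size_iota in hasP.
rewrite nth_iota // add0n => /existsP[b bw]; exists b.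
by rewrite /reduced_word bw size_tuple /=.
Qed.

Lemma reduced_word_prod w a : reduced_word S w a -> \prod_(s <- a) s = w.
Proof. by case/andP=> /andP[_ /eqP]. Qed.

Lemma reduced_word_sub w a : reduced_word S w a -> {subset a <= S}.
Proof. by case/andP=> /andP[/allP aS _] _ x /aS. Qed.

Lemma word_for_cons w s a :
  word_for S w (s :: a) = (s \in S) && word_for S (s^-1 * w) a.
Proof.
rewrite /word_for /= big_cons -andbA; congr (_ && (_ && _)).
by rewrite -(inj_eq (mulgI s^-1)) mulKg.
Qed.

Lemma word_for_mem w a : word_for S w a -> w \in <<S>>.
Proof.
case/andP=> /allP aS /eqP <-; rewrite big_seq; apply: group_prod => s sa.
exact/mem_gen/aS.
Qed.

Lemma cox_length1 : cox_length S 1 = 0.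
Proof.
apply/eqP; rewrite -leqn0; apply: (@cox_length_le 1 [::]).
by rewrite /word_for /= big_nil.
Qed.

End Words.

(* [rt t] is the unit normal of the reflection [t] on the positive side, and
   [wt] is a family dual to the simple roots (fundamental coweights). *)
Record root_datum (R : realFieldType) (V : lmodType R) (gT : finGroupType)
    (W : {group gT}) (S : {set gT}) (dot : V -> V -> R) (act : gT -> V -> V)
    (rt wt : gT -> V) : Prop := RootDatum {
  rd_gen : <<S>>%g = W;
  rd_order : forall s, s \in S -> (s * s = 1)%g;
  rd_dotC : forall u v, dot u v = dot v u;
  rd_dotDl : forall u v z, dot (u + v)%R z = (dot u z + dot v z)%R;
  rd_dotZl : forall k u v, dot (k *: u)%R v = (k * dot u v)%R;
  rd_dot_eq0 : forall v, dot v v = 0%R -> v = 0%R;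
  rd_actD : forall g u v, act g (u + v)%R = (act g u + act g v)%R;
  rd_actZ : forall g k v, act g (k *: v)%R = (k *: act g v)%R;
  rd_act1 : forall v, act 1%g v = v;
  rd_actM : forall g h v, g \in W -> h \in W -> act (g * h)%g v = act g (act h v);
  rd_act_dot : forall g u v, g \in W -> dot (act g u) (act g v) = dot u v;
  rd_rt_unit : forall t, t \in reflections W S -> dot (rt t) (rt t) = 1%R;
  rd_act_refl : forall t v, t \in reflections W S ->
    act t v = (v - (2 * dot v (rt t)) *: rt t)%R;
  rd_rt_inj : {in reflections W S &, injective rt};
  rd_act_rt : forall g t, g \in W -> t \in reflections W S ->
    act g (rt t) = rt (t ^ g^-1)%g \/ act g (rt t) = (- rt (t ^ g^-1)%g)%R;
  rd_dual : forall r s, r \in S -> s \in S -> dot (rt r) (wt s) = (r == s)%:R%R;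
  rd_expand : forall t, t \in reflections W S ->
    rt t = (\sum_(s in S) dot (rt t) (wt s) *: rt s)%R;
  rd_ge0 : forall t s, t \in reflections W S -> s \in S ->
    (0 <= dot (rt t) (wt s))%R
}.

(** * Positive roots and simple reflections *)

Section RootDatum.

Import Order.TTheory GRing.Theory Num.Theory.
Local Open Scope ring_scope.

Variables (R : realFieldType) (V : lmodType R) (gT : finGroupType).
Variables (W : {group gT}) (S : {set gT}).
Variables (dot : V -> V -> R) (act : gT -> V -> V) (rt wt : gT -> V).
Hypothesis rd : root_datum W S dot act rt wt.

Implicit Types (s t r w g : gT) (u v z : V) (a b : seq gT).

Local Notation T := (reflections W S).

Let dotC := rd_dotC rd.
Let dotDl := rd_dotDl rd.
Let dotZl := rd_dotZl rd.

Lemma dotDr u v z : dot z (u + v) = dot z u + dot z v.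
Proof. by rewrite dotC dotDl !(dotC _ z). Qed.

Lemma dotZr k u v : dot v (k *: u) = k * dot v u.
Proof. by rewrite dotC dotZl (dotC u). Qed.

Lemma dot0l v : dot 0 v = 0.
Proof. by rewrite -[0 in LHS](scale0r 0) dotZl mul0r. Qed.

Lemma dot0r v : dot v 0 = 0.
Proof. by rewrite dotC dot0l. Qed.

Lemma dotNl u v : dot (- u) v = - dot u v.
Proof. by rewrite -scaleN1r dotZl mulN1r. Qed.

Lemma dotNr u v : dot v (- u) = - dot v u.
Proof. by rewrite dotC dotNl dotC. Qed.

Lemma dot_suml (I : Type) (r : seq I) (P : pred I) (F : I -> V) v :
  dot (\sum_(i <- r | P i) F i) v = \sum_(i <- r | P i) dot (F i) v.
Proof.
by apply: (big_morph (fun u => dot u v)) => [x y|]; rewrite ?dot0l // dotDl.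
Qed.

Lemma dot_sumr (I : Type) (r : seq I) (P : pred I) (F : I -> V) v :
  dot v (\sum_(i <- r | P i) F i) = \sum_(i <- r | P i) dot v (F i).
Proof. by rewrite dotC dot_suml; apply: eq_bigr => i _; rewrite dotC. Qed.

Definition dotE := (dotDl, dotDr, dotNl, dotNr, dotZl, dotZr, dot0l, dot0r).

Lemma actN g v : act g (- v) = - act g v.
Proof. by rewrite -scaleN1r (rd_actZ rd) scaleN1r. Qed.

Lemma act0 g : act g 0 = 0.
Proof. by rewrite -[0 in LHS](scale0r 0) (rd_actZ rd) scale0r. Qed.

Lemma act_sum g (I : Type) (r : seq I) (P : pred I) (F : I -> V) :
  act g (\sum_(i <- r | P i) F i) = \sum_(i <- r | P i) act g (F i).
Proof.
apply: (big_morph (act g)) => [x y|]; first exact: rd_actD rd _ _ _.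
exact: act0.
Qed.

Lemma actK g v : g \in W -> act g^-1%g (act g v) = v.
Proof. by move=> gW; rewrite -(rd_actM rd) ?groupV // mulVg (rd_act1 rd). Qed.

Lemma actKV g v : g \in W -> act g (act g^-1%g v) = v.
Proof. by move=> gW; rewrite -(rd_actM rd) ?groupV // mulgV (rd_act1 rd). Qed.

Lemma dot_actl g u v : g \in W -> dot (act g u) v = dot u (act g^-1%g v).
Proof. by move=> gW; rewrite -{1}(actKV v gW) (rd_act_dot rd). Qed.

Lemma simple_refl s : s \in S -> s \in T.
Proof. by move=> sS; apply/imset2P; exists s 1%g; rewrite ?group1 ?conjg1. Qed.

Lemma simple_mem s : s \in S -> s \in W.
Proof. by rewrite -(rd_gen rd); exact: mem_gen. Qed.

Lemma simpleV s : s \in S -> s^-1%g = s.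
Proof. by move=> /(rd_order rd) ss1; apply: (mulgI s); rewrite mulgV ss1. Qed.

Lemma reflJ t g : t \in T -> g \in W -> (t ^ g)%g \in T.
Proof.
case/imset2P=> s h sS hW ->{t} gW; rewrite -conjgM.
by apply/imset2P; exists s (h * g)%g; rewrite ?groupM.
Qed.

Lemma refl_mem t : t \in T -> t \in W.
Proof. by case/imset2P=> s h /simple_mem sW hW ->; rewrite groupJ. Qed.

Lemma refl2 t : t \in T -> (t * t = 1)%g.
Proof.
by case/imset2P=> s h /(rd_order rd) ss1 hW ->; rewrite -conjMg ss1 conj1g.
Qed.

Lemma reflV t : t \in T -> t^-1%g = t.
Proof. by move=> /refl2 tt1; apply: (mulgI t); rewrite mulgV tt1. Qed.

Lemma conjg_simple s t : s \in S -> (t ^ s = s * t * s)%g.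
Proof. by move=> sS; rewrite conjgE simpleV // mulgA. Qed.

Lemma conjg_simpleK s t : s \in S -> ((t ^ s) ^ s = t)%g.
Proof. by move=> sS; rewrite -conjgM (rd_order rd) ?conjg1. Qed.

Lemma conjg_simple_id s : (s ^ s)%g = s.
Proof. by rewrite conjgE mulKg. Qed.

Lemma conjg_simple_eq s t : s \in S -> ((t ^ s)%g == s) = (t == s).
Proof. by move=> sS; rewrite -{2}(conjg_simple_id s) (inj_eq (conjg_inj s)). Qed.

Local Notation coor v s := (dot v (wt s)).

Lemma coor_act_simple s r v : s \in S -> r \in S -> r != s ->
  coor (act s v) r = coor v r.
Proof.
move=> sS rS rs; rewrite (rd_act_refl rd) ?simple_refl // !dotE.
by rewrite (rd_dual rd) // eq_sym (negbTE rs) mulr0 subr0.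
Qed.

Lemma coor_act_simple_id s v : s \in S ->
  coor (act s v) s = coor v s - 2 * dot v (rt s).
Proof.
move=> sS; rewrite (rd_act_refl rd) ?simple_refl // !dotE.
by rewrite (rd_dual rd) // eqxx mulr1.
Qed.

Lemma act_simple_wt s r : s \in S -> r \in S -> r != s -> act s (wt r) = wt r.
Proof.
move=> sS rS rs; rewrite (rd_act_refl rd) ?simple_refl // dotC.
by rewrite (rd_dual rd) // eq_sym (negbTE rs) mulr0 scale0r subr0.
Qed.

Lemma act_word_wt r a : r \in S -> {subset a <= S} -> r \notin a ->
  act (\prod_(s <- a) s)%g (wt r) = wt r.
Proof.
move=> rS; elim: a => [|s a IHa] aS; first by rewrite big_nil (rd_act1 rd).
rewrite inE negb_or => /andP[rs ra].
have sS : s \in S by apply: aS; rewrite mem_head.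
have aS' : {subset a <= S} by move=> x xa; apply: aS; rewrite inE xa orbT.
rewrite big_cons (rd_actM rd) ?IHa ?act_simple_wt ?(simple_mem sS) //.
by rewrite big_seq group_prod // => x /aS' /simple_mem.
Qed.

Lemma rt_neq0 t : t \in T -> rt t != 0.
Proof.
move=> tT; apply/eqP=> t0; have := rd_rt_unit rd tT.
by rewrite t0 dot0l => /eqP; rewrite eq_sym oner_eq0.
Qed.

Lemma rt_eq_scale t s k : t \in T -> s \in T -> 0 <= k -> rt t = k *: rt s -> t = s.
Proof.
move=> tT sT k0 tE; apply: (rd_rt_inj rd) => //; rewrite tE.
have := rd_rt_unit rd tT; rewrite tE !dotE (rd_rt_unit rd) // mulr1 => kk.
suff -> : k = 1 by rewrite scale1r.
nra.
Qed.

Lemma rt_simple_supp t s : t \in T -> s \in S ->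
  (forall r, r \in S -> r != s -> coor (rt t) r = 0) -> t = s.
Proof.
move=> tT sS t0; apply: (@rt_eq_scale _ _ (coor (rt t) s)) => //.
- exact: simple_refl.
- exact: rd_ge0 rd _ _ _ _.
rewrite {1}(rd_expand rd tT) (bigD1 s) //= big1 ?addr0 // => r /andP[rS rs].
by rewrite t0 // scale0r.
Qed.

(** Only the coordinate at [s] changes. If the image were a negative root, all other coordinates of
    [rt t] would vanish, leaving [t = s]. *)
Lemma act_simple_rt s t : s \in S -> t \in T -> t != s -> act s (rt t) = rt (t ^ s)%g.
Proof.
move=> sS tT ts; have [] := rd_act_rt rd (simple_mem sS) tT; rewrite simpleV //.
move=> tE; case/eqP: ts; apply: rt_simple_supp => // r rS rs.
apply: le_anti; rewrite (rd_ge0 rd) // andbT.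
rewrite -(@coor_act_simple s) // tE dotNl oppr_le0 (rd_ge0 rd) //.
exact: reflJ (simple_mem sS).
Qed.

Lemma act_simple_self s : s \in S -> act s (rt s) = - rt s.
Proof.
move=> sS; rewrite (rd_act_refl rd) ?simple_refl // (rd_rt_unit rd) ?simple_refl //.
by rewrite mulr1 scaler_nat mulr2n opprD addrA subrr add0r.
Qed.

(* Any positive combination of the coweights would do. *)
Definition rho : V := \sum_(s in S) wt s.

(** * Inversions and length *)

Lemma dot_rho v : dot v rho = \sum_(s in S) coor v s.
Proof. exact: dot_sumr. Qed.

Lemma ht_gt0 t : t \in T -> 0 < dot (rt t) rho.
Proof.
move=> tT; rewrite dot_rho lt0r sumr_ge0 ?andbT; last by move=> s; exact: rd_ge0 rd _ _ _.
apply: contra (rt_neq0 tT); rewrite psumr_eq0; last by move=> s; exact: rd_ge0 rd _ _ _.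
move/allP=> t0; rewrite (rd_expand rd tT) big1 // => s sS.
by have := t0 s; rewrite mem_index_enum sS => /(_ isT)/eqP ->; rewrite scale0r.
Qed.

(** The mirror of [t] separates [rho] from [act w rho], as positive roots are positive on [rho];
    [inv_length] identifies this with the condition on lengths. *)
Definition inv w t : bool := dot (rt t) (act w rho) < 0.

Lemma invE w t : w \in W -> inv w t = (dot (act w^-1%g (rt t)) rho < 0).
Proof. by move=> wW; rewrite /inv dot_actl ?groupV // invgK. Qed.

Lemma inv_dot_neq0 w t : w \in W -> t \in T -> dot (rt t) (act w rho) != 0.
Proof.
move=> wW tT; have := dot_actl (rt t) rho (groupVr wW); rewrite invgK => <-.
have tT' : (t ^ w)%g \in T by exact: reflJ.
have [] := rd_act_rt rd (groupVr wW) tT; rewrite invgK => ->.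
  by rewrite gt_eqF ?ht_gt0.
by rewrite dotNl oppr_eq0 gt_eqF ?ht_gt0.
Qed.

Lemma invN w t : w \in W -> t \in T -> ~~ inv w t = (0 < dot (rt t) (act w rho)).
Proof. by move=> wW tT; rewrite /inv -leNgt lt0r inv_dot_neq0. Qed.

Lemma inv1 t : t \in T -> inv 1%g t = false.
Proof. by move=> /ht_gt0 t0; rewrite /inv (rd_act1 rd) lt_gtF. Qed.

Lemma inv_refl w t : w \in W -> t \in T -> inv (t * w)%g t = ~~ inv w t.
Proof.
move=> wW tT; have tW := refl_mem tT.
rewrite invN // /inv (rd_actM rd) // dotC dot_actl // reflV //.
rewrite (rd_act_refl rd _ tT) !dotE (rd_rt_unit rd) // dotC.
by apply/idP/idP; lra.
Qed.

Lemma inv_simple w s t : w \in W -> s \in S -> t \in T -> t != s ->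
  inv (s * w)%g (t ^ s)%g = inv w t.
Proof.
move=> wW sS tT ts; have sW := simple_mem sS.
by rewrite /inv (rd_actM rd) // -act_simple_rt // (rd_act_dot rd).
Qed.

(** The strong exchange condition. A first letter other than [t] hands a conjugate of [t] on to the
    rest of the word; the letter that equals the current conjugate is deleted. *)
Lemma exchange w t b : word_for S w b -> t \in T -> inv w t ->
  exists2 b', word_for S (t * w)%g b' & (size b' < size b)%N.
Proof.
elim: b w t => [|s b IHb] w t.
  case/andP=> _ /eqP <-; rewrite big_nil => tT; by rewrite inv1.
rewrite word_for_cons => /andP[sS bw] tT wt_.
have wW : w \in W.
  have := word_for_mem bw; rewrite (rd_gen rd) groupMl ?groupV //; exact: simple_mem.
have [ts|ts] := eqVneq t s.
  by exists b => //; move: bw; rewrite ts simpleV.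
rewrite simpleV // in bw.
have [||b' b'w ltb] := IHb _ (t ^ s)%g bw.
- exact: reflJ (simple_mem sS).
- by rewrite inv_simple.
exists (s :: b') => //; rewrite word_for_cons sS simpleV //.
by move: b'w; rewrite conjg_simple // -!mulgA (mulgA s s) (rd_order rd) // mul1g.
Qed.

Lemma inv_length w t : w \in W -> t \in T ->
  inv w t = (cox_length S (t * w)%g < cox_length S w)%N.
Proof.
have aux x : x \in W -> t \in T -> inv x t ->
    (cox_length S (t * x)%g < cox_length S x)%N.
  rewrite -(rd_gen rd) => /reduced_word_exists[b /andP[bx /eqP <-]] tT xt.
  have [b' b'x ltb] := exchange bx tT xt.
  exact: leq_ltn_trans (cox_length_le b'x) ltb.
move=> wW tT; have [wt_|wt_] := boolP (inv w t); first by rewrite aux.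
(* [t] is an inversion of exactly one of [w] and [t * w], so the converse is the first claim for
   [t * w]. *)
have := @aux (t * w)%g; rewrite groupM ?(refl_mem tT) // => /(_ isT tT).
rewrite inv_refl // wt_ => /(_ isT).
by rewrite mulgA refl2 // mul1g => ltw; rewrite ltnNge ltnW.
Qed.

Lemma inversionsE w t : w \in W -> (t \in inversions W S w) = (t \in T) && inv w t.
Proof. by move=> wW; rewrite inE; case tT: (t \in T); rewrite //= inv_length. Qed.

Lemma length_simple w s : w \in W -> s \in S -> inv w s ->
  cox_length S w = (cox_length S (s * w)%g).+1.
Proof.
move=> wW sS ws; have sT := simple_refl sS; apply/eqP; rewrite eqn_leq.
rewrite -[X in _ && X]inv_length // ws andbT.
have [b bw] : exists b, reduced_word S (s * w)%g b.
  by apply: reduced_word_exists; rewrite (rd_gen rd) groupM ?(simple_mem sS).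
have /andP[bw' /eqP <-] := bw; apply: (@cox_length_le _ _ _ (s :: b)).
by rewrite word_for_cons sS simpleV.
Qed.

Lemma reduced_word_cons w s b : w \in W ->
  reduced_word S w (s :: b) <-> [/\ s \in S, inv w s & reduced_word S (s * w)%g b].
Proof.
move=> wW; split=> [/andP[]|[sS ws /andP[bw /eqP lb]]]; last first.
  by rewrite /reduced_word word_for_cons sS simpleV // bw /= lb -(length_simple wW).
rewrite word_for_cons => /andP[sS]; rewrite simpleV // => bw /eqP /= lb.
have ws : inv w s.
  by rewrite inv_length ?simple_refl // -lb ltnS cox_length_le.
split=> //; rewrite /reduced_word bw /=.
by move: lb; rewrite (length_simple wW sS ws) => -[->].
Qed.

Lemma left_descent w : w \in W -> w != 1%g -> exists2 s, s \in S & inv w s.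
Proof.
move=> wW w1; have [|b bw] := @reduced_word_exists _ S w; first by rewrite (rd_gen rd).
case: b bw => [/reduced_word_prod|s b].
  by rewrite big_nil => w1'; rewrite -w1' eqxx in w1.
by case/(reduced_word_cons _ _ wW)=> sS ws _; exists s.
Qed.

(** * Parabolic subgroups through fixed coweights *)

Lemma reduced_word_mem w b : reduced_word S w b -> w \in W.
Proof. by case/andP=> /word_for_mem; rewrite (rd_gen rd). Qed.

(** [w^-1] turns [rt t] into a negative root and keeps its coordinate at [r], which is thus both
    nonnegative and nonpositive. *)
Lemma fix_wtP w r t : w \in W -> r \in S -> t \in T -> act w (wt r) = wt r ->
  inv w t -> coor (rt t) r = 0.
Proof.
move=> wW rS tT wr; rewrite invE // => wt_.
have tT' : (t ^ w)%g \in T by exact: reflJ.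
have tE : act w^-1%g (rt t) = - rt (t ^ w)%g.
  have [|] := rd_act_rt rd (groupVr wW) tT; rewrite invgK // => tE.
  by move: wt_; rewrite tE ltNge ltW ?ht_gt0.
have : coor (act w^-1%g (rt t)) r = coor (rt t) r.
  by rewrite dot_actl ?groupV // invgK wr.
rewrite tE dotNl; have := rd_ge0 rd tT' rS; have := rd_ge0 rd tT rS; lra.
Qed.

Lemma inv_word_fix w b s b' : w \in W -> {subset b <= S} ->
  reduced_word S w (b ++ s :: b') -> s \in S ->
  exists2 t, t \in T & inv w t /\ rt t = act (\prod_(r <- b) r)%g (rt s).
Proof.
elim: b w => [|r b IHb] w wW bS /= bw sS.
  exists s; first exact: simple_refl.
  by have /(reduced_word_cons _ _ wW)[] := bw; rewrite big_nil (rd_act1 rd).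
have /(reduced_word_cons _ _ wW)[rS wr bw'] := bw.
have rW := simple_mem rS.
have bS' : {subset b <= S} by move=> x xb; apply: bS; rewrite inE xb orbT.
have [t tT [wt_ tE]] := IHb (r * w)%g (groupM rW wW) bS' bw' sS.
have tr : t != r.
  by apply: contraTneq wt_ => ->; rewrite inv_refl ?simple_refl // wr.
exists (t ^ r)%g; first exact: reflJ.
split.
  move: wt_; rewrite -(inv_simple (groupM rW wW) rS tT tr).
  by rewrite mulgA (rd_order rd) // mul1g.
rewrite big_cons (rd_actM rd) // -?tE ?act_simple_rt //.
by rewrite big_seq group_prod // => x /bS' /simple_mem.
Qed.

(** The letters before the first [r] fix [wt r], so the inversion read off at that [r] would have
    coordinate 1 at [r], against [fix_wtP]. With [word_fix_wt], fixing [wt r] amounts to lying in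
    the parabolic subgroup that omits [r]. *)
Lemma fix_wt_word w b r : r \in S -> reduced_word S w b -> act w (wt r) = wt r ->
  r \notin b.
Proof.
move=> rS bw wr; apply/negP=> rb; have wW := reduced_word_mem bw.
have bS := reduced_word_sub bw.
pose b1 := take (index r b) b.
have rb1 : r \notin b1 by rewrite in_take_leq ?index_size // ltnn.
have bE : b = b1 ++ r :: drop (index r b).+1 b.
  by rewrite -{1}(cat_take_drop (index r b) b) (drop_nth r) ?index_mem // nth_index.
rewrite bE in bS bw.
have b1S : {subset b1 <= S} by move=> x xb; apply: bS; rewrite mem_cat xb.
have [t tT [wt_ tE]] := inv_word_fix wW b1S bw rS.
have := fix_wtP wW rS tT wr wt_; rewrite tE dot_actl; last first.
  by rewrite big_seq group_prod // => x /b1S /simple_mem.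
rewrite -{1}(act_word_wt rS b1S rb1) actK ?(rd_dual rd) // ?eqxx.
  by move/eqP; rewrite oner_eq0.
by rewrite big_seq group_prod // => x /b1S /simple_mem.
Qed.

Lemma word_fix_wt w b r : r \in S -> reduced_word S w b -> r \notin b ->
  act w (wt r) = wt r.
Proof.
move=> rS bw rb; rewrite -(reduced_word_prod bw); apply: act_word_wt => //.
exact: reduced_word_sub bw.
Qed.

Lemma uniq_word_moves a r : {subset a <= S} -> uniq a -> r \in a ->
  act (\prod_(s <- a) s)%g (wt r) <> wt r.
Proof.
move=> aS ua ra; case/path.splitP: {a}ra aS ua => a1 a2 aS.
rewrite cat_rcons cat_uniq /= negb_or => /and4P[ua1 /andP[ra1 _] ra2 ua2].
rewrite cat_rcons in aS.
have a1S : {subset a1 <= S} by move=> x xb; apply: aS; rewrite mem_cat xb.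
have a2S : {subset a2 <= S} by move=> x xb; apply: aS; rewrite mem_cat inE xb !orbT.
have rS : r \in S by apply: aS; rewrite mem_cat mem_head orbT.
have w1W : (\prod_(s <- a1) s)%g \in W.
  by rewrite big_seq group_prod // => x /a1S /simple_mem.
have w2W : (\prod_(s <- a2) s)%g \in W.
  by rewrite big_seq group_prod // => x /a2S /simple_mem.
have rW := simple_mem rS.
rewrite big_cat big_cons /= !(rd_actM rd) ?groupM // (act_word_wt rS a2S ra2) => E.
have : act r (wt r) = wt r.
  by rewrite -(actK (act r (wt r)) w1W) E -{1}(act_word_wt rS a1S ra1) actK.
move/(congr1 (dot (rt r))); rewrite (rd_act_refl rd) ?simple_refl // !dotE.
by rewrite (rd_rt_unit rd) ?simple_refl // (dotC (wt r)) (rd_dual rd) // eqxx mulr1n; lra.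
Qed.

(** A reduced word of the product contains every letter of [a], since a product omitting a letter
    fixes its coweight; it is thus no shorter than [a]. *)
Lemma uniq_reduced_word a : {subset a <= S} -> uniq a ->
  reduced_word S (\prod_(s <- a) s)%g a.
Proof.
move=> aS ua; have aw : word_for S (\prod_(s <- a) s)%g a.
  by rewrite /word_for eqxx andbT; apply/allP.
have [b bw] := reduced_word_exists (word_for_mem aw).
have ab : {subset a <= b}.
  move=> r ra; apply/negPn/negP=> rb; apply: (uniq_word_moves aS ua ra).
  by apply: (word_fix_wt _ bw rb); exact: aS.
rewrite /reduced_word aw eqn_leq cox_length_le // andbT.
by have /andP[_ /eqP <-] := bw; exact: uniq_leq_size.
Qed.

Lemma coxeter_word_perm c a : coxeter_element S c -> reduced_word S c a ->
  perm_eq a (enum S).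
Proof.
case=> d dc dS ac.
have ud : uniq d by rewrite (perm_uniq dS) enum_uniq.
have da : {subset d <= a}.
  move=> r rd_; apply/negPn/negP=> ra.
  have := uniq_word_moves (reduced_word_sub dc) ud rd_; rewrite (reduced_word_prod dc).
  by case; apply: (word_fix_wt _ ac ra); exact: (reduced_word_sub dc).
have szad : size a = size d by have /andP[_ /eqP ->] := ac; have /andP[_ /eqP ->] := dc.
have [|_ ad] := uniq_min_size ud da; first by rewrite szad.
have ua : uniq a by apply: leq_size_uniq ud da _; rewrite szad.
by apply: perm_trans dS; apply: uniq_perm.
Qed.


(** Induction on the length of [w], then on the position of the first letter of [a] that is an
    inversion: rotating past a non-inversion brings that letter forward. Shorter elements are also
    made available, for the parabolic part of [w]. *)
Lemma sort_ind (Q : seq gT -> gT -> Prop) :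
  (forall a, perm_eq a (enum S) -> Q a 1%g) ->
  (forall s a w, perm_eq (s :: a) (enum S) -> w \in W -> inv w s ->
     Q (rcons a s) (s * w)%g -> Q (s :: a) w) ->
  (forall s a w, perm_eq (s :: a) (enum S) -> w \in W -> ~~ inv w s ->
     (forall b x, perm_eq b (enum S) -> x \in W ->
        (cox_length S x < cox_length S w)%N -> Q b x) ->
     Q (rcons a s) w -> Q (s :: a) w) ->
  forall a w, perm_eq a (enum S) -> w \in W -> Q a w.
Proof.
move=> Q1 Qinv Qninv a w; have [m] := ubnP (cox_length S w).
elim: m a w => // m IHm a w; rewrite ltnS => lt_m aS wW.
have [->|w1] := eqVneq w 1%g; first exact: Q1.
have [r rS wr] := left_descent wW w1.
have [k] := ubnP (find (inv w) a); elim: k a aS => // k IHk [|s a] aS lt_k.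
  by have := perm_mem aS r; rewrite mem_enum rS.
have sS : s \in S by rewrite -mem_enum -(perm_mem aS) mem_head.
have aS' : perm_eq (rcons a s) (enum S) by rewrite perm_rcons.
have [ws|ws] := boolP (inv w s).
  apply: Qinv => //; apply: IHm => //; last by rewrite groupM ?(simple_mem sS).
  by rewrite (length_simple wW sS ws) in lt_m.
apply: Qninv => // [b x bS xW lt_x|]; first by apply: IHm => //; exact: leq_trans lt_m.
apply: IHk => //; move: lt_k; rewrite /= (negbTE ws) -cats1 find_cat.
suff -> : has (inv w) a by lia.
apply/hasP; exists r => //; have := perm_mem aS r; rewrite mem_enum rS inE.
by case: eqP wr ws => //= -> ->.
Qed.

(** * The skew form of a word *)

Lemma simple_obtuse s r : s \in S -> r \in S -> r != s -> dot (rt s) (rt r) <= 0.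
Proof.
move=> sS rS rs; have rT := simple_refl rS.
have := coor_act_simple_id (rt r) sS; rewrite act_simple_rt // (rd_dual rd rS sS).
rewrite (negbTE rs) sub0r (dotC (rt r)) => E.
by have := rd_ge0 rd (reflJ rT (simple_mem sS)) sS; rewrite E; lra.
Qed.

(** The value of the skew form at the first letter, by [om_first]. On a positive root it is also the
    coordinate at [s] minus the product with [rt s], by [dot_first]. *)
Definition mm a s v : R := - \sum_(r <- a) dot (rt s) (rt r) * coor v r.

(* The skew form with [om a (rt r) (rt s) = - dot (rt r) (rt s)] when [r]
   precedes [s] in [a]. *)
Fixpoint om a u v : R :=
  if a is s :: a' then coor u s * mm a' s v - coor v s * mm a' s u + om a' u v
  else 0.

Lemma mmD a s u v : mm a s (u + v) = mm a s u + mm a s v.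
Proof.
rewrite /mm -opprD -big_split; congr (- _); apply: eq_bigr => r _ /=.
by rewrite dotDl mulrDr.
Qed.

Lemma mmZ a s k u : mm a s (k *: u) = k * mm a s u.
Proof.
rewrite /mm mulrN mulr_sumr; congr (- _); apply: eq_bigr => r _ /=.
by rewrite dotZl mulrCA.
Qed.

Lemma eq_mm a s u v : {in a, forall r, coor u r = coor v r} -> mm a s u = mm a s v.
Proof. by move=> uv; congr (- _); apply: eq_big_seq => r /uv ->. Qed.

Lemma mm0 a s u : {in a, forall r, coor u r = 0} -> mm a s u = 0.
Proof.
by move=> u0; rewrite /mm big_seq big1 ?oppr0 // => r /u0 ->; rewrite mulr0.
Qed.

Lemma omC a u v : om a v u = - om a u v.
Proof. by elim: a => [|s a IHa] /=; rewrite ?oppr0 // IHa; ring. Qed.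

Lemma omDl a u v z : om a (u + v) z = om a u z + om a v z.
Proof. by elim: a => [|s a IHa] /=; rewrite ?addr0 // IHa mmD dotDl; ring. Qed.

Lemma omZl a k u v : om a (k *: u) v = k * om a u v.
Proof. by elim: a => [|s a IHa] /=; rewrite ?mulr0 // IHa mmZ dotZl; ring. Qed.

Lemma eq_om a u v u' v' : {in a, forall r, coor u r = coor u' r} ->
  {in a, forall r, coor v r = coor v' r} -> om a u v = om a u' v'.
Proof.
elim: a => //= s a IHa uu vv.
have sub r : r \in a -> r \in s :: a by rewrite inE orbC => ->.
rewrite uu ?mem_head // vv ?mem_head // (@eq_mm _ _ v v') 1?(@eq_mm _ _ u u').
- by rewrite IHa // => r /sub; [exact: uu|exact: vv].
- by move=> r /sub; exact: uu.
- by move=> r /sub; exact: vv.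
Qed.

Lemma om0l a u v : {in a, forall r, coor u r = 0} -> om a u v = 0.
Proof.
elim: a => //= s a IHa u0.
have sub r : r \in a -> r \in s :: a by rewrite inE orbC => ->.
have u0a : {in a, forall r, coor u r = 0} by move=> r /sub /u0.
by rewrite u0 ?mem_head // (mm0 s u0a) (IHa u0a); ring.
Qed.

(** A letter contributes the same terms at either end of the word, with opposite signs. *)
Lemma om_rcons a s u v :
  om (rcons a s) u v = om a u v - (coor u s * mm a s v - coor v s * mm a s u).
Proof.
elim: a => [|r a IHa] /=; first by rewrite /mm !big_nil; ring.
rewrite IHa /mm -cats1 !big_cat !big_cons !big_nil /= (dotC (rt s) (rt r)); ring.
Qed.

Section FirstLetter.

Variables (s : gT) (a : seq gT).
Hypothesis saS : perm_eq (s :: a) (enum S).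

Lemma first_simple : s \in S.
Proof. by rewrite -mem_enum -(perm_mem saS) mem_head. Qed.

Lemma tail_simple r : r \in a -> r \in S.
Proof. by move=> ra; rewrite -mem_enum -(perm_mem saS) inE ra orbT. Qed.

Lemma first_notin_tail : s \notin a.
Proof. by have := perm_uniq saS; rewrite enum_uniq /= => /andP[]. Qed.

Lemma tail_neq r : r \in a -> r != s.
Proof. by apply: contraTneq => ->; exact: first_notin_tail. Qed.

Lemma rot_perm : perm_eq (rcons a s) (enum S).
Proof. by rewrite perm_rcons. Qed.

Let sS := first_simple.
Let sT := simple_refl sS.

Lemma dot_first t : t \in T -> dot (rt s) (rt t) = coor (rt t) s - mm a s (rt t).
Proof.
move=> tT; rewrite {1}(rd_expand rd tT) dot_sumr -big_enum.
rewrite -(perm_big _ saS) big_cons /= dotZr (rd_rt_unit rd) // mulr1 opprK.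
by congr (_ + _); apply: eq_bigr => r _; rewrite dotZr mulrC.
Qed.

Lemma mm_ge0 t : t \in T -> 0 <= mm a s (rt t).
Proof.
move=> tT; rewrite oppr_ge0 big_seq sumr_le0 // => r ra.
by rewrite mulr_le0_ge0 ?(rd_ge0 rd) ?simple_obtuse ?tail_neq ?(tail_simple ra).
Qed.

Lemma coor_first_tail r : r \in a -> coor (rt s) r = 0.
Proof.
by move=> ra; rewrite (rd_dual rd) ?(tail_simple ra) // eq_sym (negbTE (tail_neq ra)).
Qed.

Lemma om_first v : om (s :: a) (rt s) v = mm a s v.
Proof.
rewrite /= (om0l _ coor_first_tail) (mm0 s coor_first_tail).
by rewrite (rd_dual rd) // eqxx mulr1n; ring.
Qed.

Lemma om_last v : om (rcons a s) (rt s) v = - mm a s v.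
Proof.
rewrite om_rcons (om0l _ coor_first_tail) (mm0 s coor_first_tail).
by rewrite (rd_dual rd) // eqxx mulr1n; ring.
Qed.

(** Only the coordinate at [s] changes under [s]: by [dot_first] it goes from [x] to [2 * m - x],
    where [m] is the value of [mm a s]. The products of the two [m] cancel, and the sign compensates
    the one in [om_rcons]. *)
Lemma om_rot t1 t2 : t1 \in T -> t2 \in T ->
  om (rcons a s) (act s (rt t1)) (act s (rt t2)) = om (s :: a) (rt t1) (rt t2).
Proof.
have coorE t : {in a, forall r, coor (act s (rt t)) r = coor (rt t) r}.
  by move=> r ra; rewrite coor_act_simple ?(tail_simple ra) ?tail_neq.
move=> t1T t2T; rewrite om_rcons /= (eq_om (coorE t1) (coorE t2)).
rewrite (eq_mm _ (coorE t1)) (eq_mm _ (coorE t2)) !coor_act_simple_id //.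
by rewrite !(dotC _ (rt s)) !dot_first //; ring.
Qed.

(** If [mm a s (rt t)] vanished, [dot (rt s) (rt t)] would be the coordinate of [rt t] at [s], and
    that of the positive root [act s (rt t)] would be its opposite; both would be zero. *)
Lemma om_first_gt0 t : t \in T -> t != s -> dot (rt s) (rt t) != 0 ->
  0 < om (s :: a) (rt s) (rt t).
Proof.
move=> tT ts; rewrite om_first lt0r mm_ge0 // andbT; apply: contra => /eqP m0.
have := dot_first tT; have := coor_act_simple_id (rt t) sS.
rewrite act_simple_rt // m0 (dotC (rt t) (rt s)) => E1 E2.
have := rd_ge0 rd (reflJ tT (simple_mem sS)) sS; have := rd_ge0 rd tT sS.
by rewrite E1 E2 => *; apply/eqP; lra.
Qed.

End FirstLetter.

(** Compare coordinates at the first letter [s]: the other letters do not change this coordinate,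
    while [s] changes it by twice the product with [rt s]. So this product is zero, [s] fixes [v],
    and the next letter can be treated. *)
Lemma cox_fix_orth a v : {subset a <= S} -> uniq a ->
  act (\prod_(s <- a) s)%g v = v -> {in a, forall r, dot v (rt r) = 0}.
Proof.
elim: a => // s a IHa saS /= /andP[sa ua].
have sS : s \in S by apply: saS; rewrite mem_head.
have aS : {subset a <= S} by move=> r ra; apply: saS; rewrite inE ra orbT.
have aW : (\prod_(r <- a) r)%g \in W.
  by rewrite big_seq group_prod // => r /aS /simple_mem.
have sW := simple_mem sS.
rewrite big_cons (rd_actM rd) // => avE.
have avE' : act (\prod_(r <- a) r)%g v = act s v.
  by rewrite -{2}avE -(rd_actM rd) // (rd_order rd) // (rd_act1 rd).
have v0 : dot v (rt s) = 0.
  have := coor_act_simple_id v sS; rewrite -avE' dot_actl //.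
  by rewrite -{1}(act_word_wt sS aS sa) actK //; lra.
move=> r; rewrite inE => /orP[/eqP -> //|]; apply: IHa => //.
by rewrite avE' (rd_act_refl rd) ?simple_refl // v0 mulr0 scale0r subr0.
Qed.

(* [t] becomes the first letter within [k] rotations. *)
Fixpoint hit (k : nat) a t : bool :=
  match k, a with
  | k'.+1, s :: a' => (t == s) || hit k' (rcons a' s) (t ^ s)%g
  | _, _ => false
  end.

Lemma not_hit_cat b d t : {subset b <= S} -> t \in T ->
  (forall k, ~~ hit k (b ++ d) t) ->
  act (\prod_(s <- b) s)^-1%g (rt t) = rt (t ^ (\prod_(s <- b) s))%g /\
  (forall k, ~~ hit k (d ++ b) (t ^ (\prod_(s <- b) s))%g).
Proof.
elim: b d t => [|s b IHb] d t sbS tT nohit.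
  by rewrite big_nil invg1 conjg1 (rd_act1 rd) cats0; split.
have sS : s \in S by apply: sbS; rewrite mem_head.
have bS : {subset b <= S} by move=> r rb; apply: sbS; rewrite inE rb orbT.
have bW : (\prod_(r <- b) r)%g \in W.
  by rewrite big_seq group_prod // => r /bS /simple_mem.
have sW := simple_mem sS.
have ts : t != s by have := nohit 1; rewrite /= orbF.
have nohit' k : ~~ hit k (b ++ rcons d s) (t ^ s)%g.
  by have := nohit k.+1; rewrite /= negb_or rcons_cat => /andP[].
have [E nohit2] := IHb _ _ bS (reflJ tT sW) nohit'.
rewrite big_cons conjgM; split=> [|k]; last by have := nohit2 k; rewrite cat_rcons.
by rewrite invMg (rd_actM rd) ?groupV // (simpleV sS) act_simple_rt.
Qed.

(** Otherwise all images of [rt t] under powers of the inverse of the Coxeter element are positive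
    roots. Their sum is fixed, hence orthogonal to all roots and so to itself, although it is
    positive on [rho]. *)
Lemma exists_hit a t : perm_eq a (enum S) -> t \in T -> exists k, hit k a t.
Proof.
move=> aS tT; have [//|nohit] := pselect (exists k, hit k a t).
have sub r : r \in a -> r \in S by rewrite (perm_mem aS) mem_enum.
have ua : uniq a by rewrite (perm_uniq aS) enum_uniq.
pose c := (\prod_(s <- a) s)%g.
have cW : c \in W by rewrite /c big_seq group_prod // => r /sub /simple_mem.
have step j : act c^-1%g (rt (t ^ (c ^+ j))%g) = rt (t ^ (c ^+ j.+1))%g /\
    (forall k, ~~ hit k a (t ^ (c ^+ j.+1))%g).
  elim: j => [|j [_ IHj]].
    rewrite expg0 expg1 conjg1; have := @not_hit_cat a [::] t sub tT.
    by rewrite cats0; apply=> k; apply/negP=> h; apply: nohit; exists k.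
  have := @not_hit_cat a [::] (t ^ (c ^+ j.+1))%g sub.
  rewrite cats0 -/c -!conjgM -!expgSr; apply=> //.
  by rewrite reflJ ?groupX.
pose v := \sum_(j < #[c]%g) rt (t ^ (c ^+ j))%g.
have cv : act c^-1%g v = v.
  rewrite act_sum; under eq_bigr => j _ do rewrite (step j).1.
  rewrite /v; case E: #[c]%g (order_gt0 c) => [//|m] _.
  rewrite big_ord_recr big_ord_recl /= addrC; congr (_ + _).
  by rewrite -E expg_order expg0.
have vrt r : r \in S -> dot v (rt r) = 0.
  move=> rS; apply: (@cox_fix_orth a) => //; first by rewrite -/c -{1}cv actKV.
  by rewrite (perm_mem aS) mem_enum.
have jT j : (t ^ (c ^+ j))%g \in T by rewrite reflJ ?groupX.
have vT t' : t' \in T -> dot v (rt t') = 0.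
  move=> t'T; rewrite (rd_expand rd t'T) dot_sumr big1 // => r rS.
  by rewrite dotZr vrt ?mulr0.
have v0 : v = 0.
  by apply: (rd_dot_eq0 rd); rewrite {2}/v dot_sumr big1 // => j _; rewrite vT.
have : 0 < dot v rho.
  rewrite /v dot_suml; case: #[c]%g (order_gt0 c) => [//|m] _.
  rewrite big_ord_recl ltr_pwDl ?ht_gt0 // sumr_ge0 // => j _.
  exact/ltW/ht_gt0.
by rewrite v0 dot0l ltxx.
Qed.

(* Conjugating the word by its successive first letters, every reflection
   eventually becomes the first letter, because the Coxeter element has no
   nonzero fixed vector in the span of the roots. *)
Lemma rot_ind (Q : seq gT -> gT -> Prop) :
  (forall s a, perm_eq (s :: a) (enum S) -> Q (s :: a) s) ->
  (forall s a t, perm_eq (s :: a) (enum S) -> t \in T -> t != s ->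
     Q (rcons a s) (t ^ s)%g -> Q (s :: a) t) ->
  forall a t, perm_eq a (enum S) -> t \in T -> Q a t.
Proof.
move=> Q1 Qrot a t aS tT; have [k] := exists_hit aS tT.
elim: k a t aS tT => // k IHk [|s a] t aS tT //=.
have [-> _|ts /= h] := eqVneq t s; first exact: Q1.
apply: Qrot => //; apply: IHk => //; first exact: rot_perm.
by rewrite reflJ ?simple_mem // (first_simple aS).
Qed.

(** Rotation preserves the form, so one may wait until one of the two reflections is the first
    letter; then [om_first_gt0] applies. *)
Lemma om_neq0 a t1 t2 : perm_eq a (enum S) -> t1 \in T -> t2 \in T -> t1 != t2 ->
  dot (rt t1) (rt t2) != 0 -> om a (rt t1) (rt t2) != 0.
Proof.
move=> aS t1T; move: a t1 aS t1T t2.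
apply: rot_ind => [s a saS t2 t2T st2 d0|s a t1 saS t1T t1s IH t2 t2T t12 d0].
  by rewrite gt_eqF // om_first_gt0 // eq_sym.
have sS := first_simple saS.
have [t2s|t2s] := eqVneq t2 s.
  by rewrite t2s omC oppr_eq0 gt_eqF // om_first_gt0 // dotC -t2s.
rewrite -om_rot // !act_simple_rt //; apply: IH.
- by rewrite reflJ ?simple_mem.
- by rewrite (inj_eq (conjg_inj s)).
- by rewrite -!act_simple_rt // (rd_act_dot rd) ?simple_mem.
Qed.

(** * Alignment for the skew form *)

(* Alignment tested on all pairs of positive roots instead
   of only on the canonical generators of rank two parabolic subgroups. *)
Definition form_aligned a w : Prop := forall t t1 t2 (x y : R),
  t \in T -> t1 \in T -> t2 \in T -> 0 < x -> 0 < y ->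
  rt t = x *: rt t1 + y *: rt t2 -> 0 < om a (rt t1) (rt t2) ->
  inv w t -> inv w t1.

Lemma inv_simpleC w s t : w \in W -> s \in S -> t \in T -> t != s ->
  inv (s * w)%g t = inv w (t ^ s)%g.
Proof.
move=> wW sS tT ts; have sW := simple_mem sS.
rewrite -[in RHS](mul1g w) -(rd_order rd sS) -mulgA inv_simple // groupM //.
Qed.

Lemma simple_indecomposable s t1 t2 (x y : R) : s \in S -> t1 \in T -> t2 \in T ->
  0 < x -> 0 < y -> rt s = x *: rt t1 + y *: rt t2 -> t1 = s /\ t2 = s.
Proof.
move=> sS t1T t2T x0 y0 sE.
have c0 r : r \in S -> r != s -> coor (rt t1) r = 0 /\ coor (rt t2) r = 0.
  move=> rS rs; have := rd_dual rd sS rS; rewrite sE eq_sym (negbTE rs) mulr0n !dotE.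
  have := rd_ge0 rd t1T rS; have := rd_ge0 rd t2T rS => c2 c1 E.
  by split; nra.
by split; apply: rt_simple_supp => // r rS rs; case: (c0 r rS rs).
Qed.

Lemma form_aligned_rot s a w : perm_eq (s :: a) (enum S) -> w \in W -> inv w s ->
  form_aligned (s :: a) w <-> form_aligned (rcons a s) (s * w)%g.
Proof.
move=> saS wW ws; have sS := first_simple saS; have sT := simple_refl sS.
have sW := simple_mem sS.
split=> al t t1 t2 x y tT t1T t2T x0 y0 tE o12.
  have [->|ts] := eqVneq t s; first by rewrite inv_refl // ws.
  rewrite inv_simpleC // => wt_.
  have t1s : t1 != s.
    apply: contraTneq o12 => ->; rewrite om_last // -leNgt oppr_le0.
    exact: mm_ge0.
  rewrite inv_simpleC //.
  have E : rt (t ^ s)%g = x *: rt (t1 ^ s)%g + y *: act s (rt t2).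
    by rewrite -!act_simple_rt // tE (rd_actD rd) !(rd_actZ rd).
  have [t2s|t2s] := eqVneq t2 s; last first.
    rewrite act_simple_rt // in E.
    apply: (al (t ^ s)%g _ (t2 ^ s)%g x y) => //; try exact: reflJ.
    rewrite -om_rot ?reflJ // !act_simple_rt ?reflJ ?conjg_simple_eq //.
    by rewrite !conjg_simpleK.
  (* Here [rt (t1 ^ s)] is a positive combination of [rt (t ^ s)] and [rt s], both negative on
     [act w rho]. *)
  move: wt_ ws; rewrite /inv E t2s act_simple_self // !dotE; nra.
move=> wt_; have [->//|t1s] := eqVneq t1 s.
have t2s : t2 != s.
  apply: contraTneq o12 => ->; rewrite omC om_first // -leNgt oppr_le0.
  exact: mm_ge0.
have ts : t != s.
  apply: contra t1s => /eqP ts; rewrite ts in tE.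
  by have [-> _] := simple_indecomposable sS t1T t2T x0 y0 tE.
rewrite -(inv_simple wW sS) //.
apply: (al (t ^ s)%g _ (t2 ^ s)%g x y) => //; try exact: reflJ.
- by rewrite -!act_simple_rt // tE (rd_actD rd) !(rd_actZ rd).
- by rewrite -!act_simple_rt // om_rot.
- by rewrite inv_simple.
Qed.

Lemma combination_coor0 t t1 t2 (x y : R) s : s \in S -> t1 \in T -> t2 \in T ->
  0 < x -> 0 < y -> rt t = x *: rt t1 + y *: rt t2 -> coor (rt t) s = 0 ->
  coor (rt t1) s = 0 /\ coor (rt t2) s = 0.
Proof.
move=> sS t1T t2T x0 y0 ->; rewrite !dotE.
have := rd_ge0 rd t1T sS; have := rd_ge0 rd t2T sS => c2 c1 E.
by split; nra.
Qed.

Lemma om_first_last s a u v : coor u s = 0 -> coor v s = 0 ->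
  om (s :: a) u v = om (rcons a s) u v.
Proof. by move=> u0 v0; rewrite om_rcons /= u0 v0; ring. Qed.

(** By [fix_wtP] every inversion of [w] has coordinate zero at [s], and so have the roots it is
    composed of; on these the position of [s] in the word is immaterial. *)
Lemma form_aligned_fix s a w : s \in S -> w \in W -> act w (wt s) = wt s ->
  form_aligned (s :: a) w <-> form_aligned (rcons a s) w.
Proof.
move=> sS wW ws; split=> al t t1 t2 x y tT t1T t2T x0 y0 tE o12 wt_;
  have [c1 c2] := combination_coor0 sS t1T t2T x0 y0 tE (fix_wtP wW sS tT ws wt_);
  by apply: (al t t1 t2 x y) => //; rewrite -?om_first_last // om_first_last.
Qed.

Lemma parabolic_factor s w : s \in S -> w \in W -> exists x y,
  [/\ x \in W /\ y \in W, w = (x * y)%g, act x (wt s) = wt s,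
      forall r, r \in S -> r != s -> ~~ inv y r
    & (cox_length S x + cox_length S y <= cox_length S w)%N].
Proof.
move=> sS; have [m] := ubnP (cox_length S w).
elim: m w => // m IHm w; rewrite ltnS => lt_m wW.
have [[r [rS rs wr]]|nor] := pselect (exists r, [/\ r \in S, r != s & inv w r]); last first.
  exists 1%g, w; rewrite group1 mul1g (rd_act1 rd) cox_length1 add0n.
  by split=> // r rS rs; apply/negP=> wr; apply: nor; exists r.
have rW := simple_mem rS.
rewrite (length_simple wW rS wr) in lt_m *.
have [x [y [[xW yW] wE xs yr lxy]]] := IHm _ lt_m (groupM rW wW).
exists (r * x)%g, y; split=> //.
- by rewrite groupM.
- by rewrite -mulgA -wE mulgA (rd_order rd) // mul1g.
- by rewrite (rd_actM rd) // xs act_simple_wt // eq_sym.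
suff : (cox_length S (r * x)%g <= (cox_length S x).+1)%N by lia.
have [|b /andP[bx /eqP <-]] := @reduced_word_exists _ S x; first by rewrite (rd_gen rd).
apply: (@cox_length_le _ _ _ (r :: b)); rewrite word_for_cons rS.
by rewrite simpleV // mulgA (rd_order rd) // mul1g.
Qed.

(** [act y rho] is positive on all simple roots except possibly [rt s], so it is positive, like
    [rho], on positive roots without coordinate at [s]. *)
Lemma inv_parabolic s x y t : s \in S -> x \in W -> y \in W ->
  act x (wt s) = wt s -> (forall r, r \in S -> r != s -> ~~ inv y r) ->
  t \in T -> coor (rt t) s = 0 -> inv (x * y)%g t = inv x t.
Proof.
move=> sS xW yW xs yr tT ts.
have t'T : (t ^ x)%g \in T by exact: reflJ.
have E : act x^-1%g (rt t) = rt (t ^ x)%g \/ act x^-1%g (rt t) = - rt (t ^ x)%g.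
  by have := rd_act_rt rd (groupVr xW) tT; rewrite invgK.
have coor0 : coor (rt (t ^ x)%g) s = 0.
  have : coor (act x^-1%g (rt t)) s = 0 by rewrite dot_actl ?groupV // invgK xs.
  by case: E => -> //; rewrite dotNl => /eqP; rewrite oppr_eq0 => /eqP.
have pos : 0 < dot (rt (t ^ x)%g) (act y rho).
  rewrite -invN //; apply/negP; rewrite /inv (rd_expand rd t'T) dot_suml.
  apply/negP; rewrite -leNgt sumr_ge0 // => r rS; rewrite dotZl.
  have [->|rs] := eqVneq r s; first by rewrite coor0 mul0r.
  by rewrite mulr_ge0 ?(rd_ge0 rd) // ltW // -invN ?yr // simple_refl.
have pos1 := ht_gt0 t'T.
rewrite /inv (rd_actM rd) //; have := dot_actl (rt t) (act y rho) (groupVr xW).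
have := dot_actl (rt t) rho (groupVr xW); rewrite invgK => <- <-.
by case: E => ->; rewrite ?dotNl; apply/idP/idP; lra.
Qed.

(** The inversion sequence: for a reduced word, the positive roots of its inversions in the order in
    which the letters produce them. *)
Fixpoint betas b : seq V :=
  if b is s :: b' then rt s :: [seq act s u | u <- betas b'] else [::].

Lemma betas_inv w b u : reduced_word S w b -> u \in betas b ->
  exists2 t, t \in T & inv w t /\ u = rt t.
Proof.
elim: b w u => // s b IHb w u sbw; have wW := reduced_word_mem sbw.
have /(reduced_word_cons _ _ wW)[sS ws bw] := sbw.
rewrite inE => /orP[/eqP ->|/mapP[v vb ->]]; first by exists s => //; exact: simple_refl.
have [t tT [swt ->]] := IHb _ _ bw vb.
have ts : t != s.
  by apply: contraTneq swt => ->; rewrite inv_refl ?simple_refl // ws.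
exists (t ^ s)%g; first by rewrite reflJ ?simple_mem.
by rewrite -inv_simpleC // act_simple_rt.
Qed.

Lemma betas_rcons b r : {subset rcons b r <= S} ->
  betas (rcons b r) = rcons (betas b) (act (\prod_(s <- b) s)%g (rt r)).
Proof.
elim: b => [|s b IHb] /= bS; first by rewrite big_nil (rd_act1 rd).
have sS : s \in S by apply: bS; rewrite mem_head.
have bS' : {subset rcons b r <= S} by move=> x xb; apply: bS; rewrite inE xb orbT.
rewrite IHb // map_rcons big_cons (rd_actM rd) ?(simple_mem sS) //.
rewrite big_seq group_prod // => x xb; apply/simple_mem/bS'.
by rewrite mem_rcons inE xb orbT.
Qed.

(** * Descent to the first letter *)

Section Descend.

Variables (s : gT) (a : seq gT).
Hypothesis saS : perm_eq (s :: a) (enum S).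
Let sS : s \in S := first_simple saS.

Lemma act_rcons b r : {subset rcons b r <= S} ->
  act (\prod_(x <- rcons b r) x)%g (rt s) =
  act (\prod_(x <- b) x)%g (rt s) +
    (- 2 * dot (rt s) (rt r)) *: act (\prod_(x <- b) x)%g (rt r).
Proof.
move=> bS; have rS : r \in S by apply: bS; rewrite mem_rcons mem_head.
have bW : (\prod_(x <- b) x)%g \in W.
  rewrite big_seq group_prod // => x xb; apply/simple_mem/bS.
  by rewrite mem_rcons inE xb orbT.
rewrite -cats1 big_cat big_cons big_nil /= mulg1 (rd_actM rd) ?(simple_mem rS) //.
rewrite (rd_act_refl rd _ (simple_refl rS)) (rd_actD rd) actN (rd_actZ rd).
by rewrite -scaleNr mulNr.
Qed.

(** The letters of [b] fix [wt s], so the coordinate at [s] stays 1, which a negative root cannot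
    have. *)
Lemma act_first_pos b : {subset b <= S} -> s \notin b ->
  exists2 t, t \in T & act (\prod_(x <- b) x)%g (rt s) = rt t.
Proof.
move=> bS sb.
have bW : (\prod_(x <- b) x)%g \in W.
  by rewrite big_seq group_prod // => x /bS /simple_mem.
have c1 : coor (act (\prod_(x <- b) x)%g (rt s)) s = 1.
  rewrite dot_actl // -{1}(act_word_wt sS bS sb) actK // (rd_dual rd) // eqxx //.
have t'T : (s ^ (\prod_(x <- b) x)^-1)%g \in T.
  by apply: reflJ; rewrite ?groupV //; exact: simple_refl.
have [E|E] := rd_act_rt rd bW (simple_refl sS); first by exists (s ^ (\prod_(x <- b) x)^-1)%g.
by move: c1; rewrite E dotNl; have := rd_ge0 rd t'T sS; lra.
Qed.

Lemma om_act_first b v : {subset b <= S} -> s \notin b ->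
  0 <= om (s :: a) (rt s) v -> all (fun u => 0 <= om (s :: a) u v) (betas b) ->
  0 <= om (s :: a) (act (\prod_(x <- b) x)%g (rt s)) v.
Proof.
move=> + + sv; elim/last_ind: b => [|b r IHb] bS sb bv.
  by rewrite big_nil (rd_act1 rd).
rewrite act_rcons // omDl omZl.
move: bv; rewrite betas_rcons // all_rcons => /andP[rv bv].
move: sb; rewrite mem_rcons inE negb_or => /andP[sr sb].
have rS : r \in S by apply: bS; rewrite mem_rcons mem_head.
have bS' : {subset b <= S} by move=> x xb; apply: bS; rewrite mem_rcons inE xb orbT.
rewrite addr_ge0 ?IHb // mulr_ge0 // mulNr oppr_ge0.
by rewrite mulr_ge0_le0 // simple_obtuse // eq_sym.
Qed.

Lemma descend w b : form_aligned (s :: a) w -> {subset b <= S} -> s \notin b ->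
  {in betas b, forall u, exists2 t, t \in T & u = rt t} ->
  pairwise (fun u v => 0 <= om (s :: a) u v) (betas b) ->
  dot (act (\prod_(x <- b) x)%g (rt s)) (act w rho) < 0 -> inv w s.
Proof.
move=> al; elim/last_ind: b => [|b r IHb] bS sb bT.
  by rewrite big_nil (rd_act1 rd).
rewrite betas_rcons // pairwise_rcons => /andP[bv bpw] neg.
move: (sb); rewrite mem_rcons inE negb_or => /andP[sr sb'].
have rS : r \in S by apply: bS; rewrite mem_rcons mem_head.
have bS' : {subset b <= S} by move=> x xb; apply: bS; rewrite mem_rcons inE xb orbT.
have bW : (\prod_(x <- b) x)%g \in W.
  by rewrite big_seq group_prod // => x /bS' /simple_mem.
apply: IHb => // [u ub|].
  by apply: bT; rewrite betas_rcons // mem_rcons inE ub orbT.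
have [t1 t1T t1E] := act_first_pos bS' sb'.
have [t tT tE] := act_first_pos bS sb.
have [|t2 t2T t2E] := bT (act (\prod_(x <- b) x)%g (rt r)).
  by rewrite betas_rcons // mem_rcons mem_head.
have tE' := tE; rewrite act_rcons // t1E t2E in tE'.
have [d0|d0] := eqVneq (dot (rt s) (rt r)) 0.
  by move: neg; rewrite tE -tE' d0 mulr0 scale0r addr0 t1E.
have dlt : dot (rt s) (rt r) < 0.
  by rewrite lt_neqAle d0 simple_obtuse // eq_sym.
have d12 : dot (rt t1) (rt t2) = dot (rt s) (rt r) by rewrite -t1E -t2E (rd_act_dot rd).
have t12 : t1 != t2.
  by apply: contraTneq dlt => t12; rewrite -d12 t12 (rd_rt_unit rd) // -leNgt.
(* The coefficients 1 and [- 2 * dot (rt s) (rt r)] are those of [act_rcons]; alignment leads from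
   the prefix with [r] to the one without it. *)
rewrite t1E; apply: (al t t1 t2 1 (- 2 * dot (rt s) (rt r))) => //.
- by rewrite mulNr oppr_gt0 pmulr_rlt0.
- by rewrite -tE' scale1r.
- rewrite lt0r om_neq0 ?d12 //= -t1E.
  apply: om_act_first => //; first by rewrite om_first // mm_ge0.
  by rewrite -t2E.
- by rewrite /inv -tE.
Qed.

End Descend.

Definition good_word a w := exists2 b, reduced_word S w b
  & pairwise (fun u v => 0 <= om a u v) (betas b).

Lemma form_aligned_fix_first s a w : perm_eq (s :: a) (enum S) -> w \in W ->
  ~~ inv w s -> form_aligned (s :: a) w ->
  (forall x, x \in W -> (cox_length S x < cox_length S w)%N ->
     form_aligned (s :: a) x -> good_word (s :: a) x) ->
  act w (wt s) = wt s.
Proof.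
move=> saS wW ws al IH; have sS := first_simple saS; have sT := simple_refl sS.
have [x [y [[xW yW] wE xs yr lxy]]] := parabolic_factor sS wW.
have [y1|y1] := eqVneq y 1%g; first by rewrite wE y1 mulg1.
have [r rS ynr] := left_descent yW y1.
have ys : inv y s by have [<-//|rs] := eqVneq r s; rewrite (negbTE (yr r rS rs)) in ynr.
have lx : (cox_length S x < cox_length S w)%N.
  by move: lxy; rewrite (length_simple yW sS ys); clear; lia.
have alx : form_aligned (s :: a) x.
  move=> t t1 t2 k1 k2 tT t1T t2T k10 k20 tE o12 xt.
  have t0 := fix_wtP xW sS tT xs xt.
  have [c1 c2] := combination_coor0 sS t1T t2T k10 k20 tE t0.
  move: xt; rewrite -!(inv_parabolic sS xW yW) // -wE => wt_.
  exact: (al t t1 t2 k1 k2).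
have [b bx bpw] := IH x xW lx alx.
case/negP: ws; apply: (descend saS al) bpw _.
- exact: reduced_word_sub bx.
- exact: fix_wt_word sS bx xs.
- by move=> u /(betas_inv bx)[t tT [_ ->]]; exists t.
(* [act x (rt s)] is negative on [act w rho] because [s] is an inversion of [y]. *)
rewrite (reduced_word_prod bx) wE (rd_actM rd) // (rd_act_dot rd) //.
Qed.

(** An inversion [s] is prefixed to the good word of [s * w]: [om] is nonnegative from the first
    letter to any positive root, and [om_rot] carries the other pairs over. Otherwise [w] fixes
    [wt s], and both forms agree on the roots of its inversions. *)
Lemma form_aligned_good_word a w : perm_eq a (enum S) -> w \in W ->
  form_aligned a w -> good_word a w.
Proof.
move: a w; apply: sort_ind => [a aS _|s a w saS wW ws IH al|s a w saS wW ws IHlt IH al].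
- exists [::] => //; rewrite /reduced_word cox_length1 /word_for big_nil eqxx //.
- have sS := first_simple saS.
  have [b bw bpw] := IH ((form_aligned_rot saS wW ws).1 al).
  exists (s :: b); first exact/reduced_word_cons.
  have bP u : u \in betas b -> exists2 t, t \in T & t != s /\ u = rt t.
    case/(betas_inv bw)=> t tT [swt ->]; exists t => //; split=> //.
    by apply: contraTneq swt => ->; rewrite inv_refl ?simple_refl // ws.
  have sW := simple_mem sS.
  rewrite [betas _]/= pairwise_cons pairwise_map; apply/andP; split.
    apply/allP=> u /mapP[v /bP[t tT [ts ->]] ->].
    rewrite act_simple_rt // om_first // mm_ge0 //.
    exact: reflJ.
  rewrite (eq_in_pairwise (P := mem (betas b)) (r' := fun u v => 0 <= om (rcons a s) u v)) //.
    move=> _ _ /bP[t tT [ts ->]] /bP[t' t'T [t's ->]].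
    transitivity (0 <= om (s :: a) (act s (rt t)) (act s (rt t'))); first by [].
    rewrite !act_simple_rt // -om_rot ?reflJ //.
    by rewrite !act_simple_rt ?reflJ ?conjg_simple_eq // !conjg_simpleK.
have sS := first_simple saS.
have ws_ : act w (wt s) = wt s.
  apply: (form_aligned_fix_first saS wW ws al) => x xW lx alx.
  exact: IHlt alx.
have [b bw bpw] := IH ((form_aligned_fix a sS wW ws_).1 al).
exists b => //.
have b0 u : u \in betas b -> coor u s = 0.
  by case/(betas_inv bw)=> t tT [wt_ ->]; exact: fix_wtP wt_.
rewrite (eq_in_pairwise (P := mem (betas b)) (r' := fun u v => 0 <= om (rcons a s) u v)) //.
  by move=> u v /b0 u0 /b0 v0; rewrite om_first_last.
Qed.

Lemma form_aligned_ninv s a w : perm_eq (s :: a) (enum S) -> w \in W ->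
  ~~ inv w s -> form_aligned (s :: a) w <->
    act w (wt s) = wt s /\ form_aligned (rcons a s) w.
Proof.
move=> saS wW ws; have sS := first_simple saS; split=> [al|[ws_ al]]; last first.
  exact/(form_aligned_fix a sS wW ws_).
have ws_ : act w (wt s) = wt s.
  apply: (form_aligned_fix_first saS wW ws al) => x xW lx alx.
  exact: form_aligned_good_word.
by split=> //; apply/(form_aligned_fix a sS wW ws_).
Qed.


(** * Sorting words *)

Lemma nth_uniq_letter a i j : uniq a -> (0 < size a)%N ->
  letter_at a i = letter_at a j -> i = j %[mod size a].
Proof.
move=> ua a0 /eqP; rewrite /letter_at nth_uniq ?ltn_pmod //; exact: eqP.
Qed.

(** For distinct letters the block condition becomes one on positions, which survives dropping
    position 0 and shifting the rest. *)
Definition nested a (p : seq nat) := forall i, (i + size a)%N \in p -> i \in p.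

Lemma block_nested a p : uniq a ->
  (forall k, block_letters a p k.+1 \subset block_letters a p k) <-> nested a p.
Proof.
move=> ua; have [/size0nil ->|a0] := posnP (size a).
  split=> [_ i|_ k]; first by rewrite addn0.
  apply/fintype.subsetP=> x; rewrite inE => /mapP[i]; rewrite mem_filter.
  by case/andP; rewrite [size _]/= divn0.
split=> [sub i ip|nest k].
  have /(fintype.subsetP (sub _)) : letter_at a i \in block_letters a p (i %/ size a).+1.
    rewrite inE; apply/mapP; exists (i + size a)%N.
      by rewrite mem_filter ip andbT divnDr ?divnn ?a0 ?addn1.
    by rewrite /letter_at modnDr.
  rewrite inE => /mapP[j]; rewrite mem_filter => /andP[/eqP dj jp].
  move/(nth_uniq_letter ua a0) => ij.
  by rewrite (divn_eq i (size a)) ij -dj -divn_eq.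
apply/fintype.subsetP=> x; rewrite inE => /mapP[i].
rewrite mem_filter => /andP[/eqP di ip] ->.
have le_i : (size a <= i)%N.
  by rewrite leqNgt; apply/negP=> lt_i; rewrite divn_small in di.
have iE : i = (i - size a + size a)%N by rewrite subnK.
rewrite inE; apply/mapP; exists (i - size a)%N; last by rewrite iE /letter_at modnDr addnK.
rewrite mem_filter nest -?iE // andbT; apply/eqP.
by move: di; rewrite iE divnDr ?divnn ?a0 ?addn1 // addnK => -[].
Qed.

Lemma letter_at_rot s a i : letter_at (s :: a) i.+1 = letter_at (rcons a s) i.
Proof.
rewrite /letter_at size_rcons [size _]/=; set m := (size a).+1.
have -> : (i.+1 %% m = (i %% m).+1 %% m)%N by rewrite -addn1 -modnDml addn1.
have lt_j : (i %% m < m)%N by rewrite ltn_pmod.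
move: (i %% m)%N lt_j => j; rewrite ltnS leq_eqVlt => /orP[/eqP ->|lt_j].
  by rewrite modnn nth_rcons ltnn eqxx.
by rewrite modn_small ?ltnS // nth_rcons lt_j.
Qed.

Lemma reduced_subword_shift s a w q :
  reduced_subword S (s :: a) w [seq i.+1 | i <- q] <->
  reduced_subword S (rcons a s) w q.
Proof.
rewrite /reduced_subword -map_comp (eq_map (letter_at_rot s a)).
rewrite sorted_map; suff -> : sorted (relpre succn ltn) q = sorted ltn q by [].
by apply: eq_sorted.
Qed.

Lemma reduced_subword_cons0 s a w q : w \in W ->
  reduced_subword S (s :: a) w (0%N :: [seq i.+1 | i <- q]) <->
  [/\ s \in S, inv w s & reduced_subword S (rcons a s) (s * w)%g q].
Proof.
move=> wW; have E : sorted ltn (0%N :: [seq i.+1 | i <- q]) = sorted ltn q.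
  rewrite /= path_sortedE; last exact: ltn_trans.
  rewrite sorted_map all_map (@eq_all _ _ predT) ?all_predT //.
have lE : letter_at (s :: a) 0 = s by rewrite /letter_at mod0n.
rewrite /reduced_subword E [map _ (_ :: _)]/= lE -map_comp (eq_map (letter_at_rot s a)).
split=> [[sq /(reduced_word_cons _ _ wW)[]]|[sS ws [sq bw]]]; first by [].
by split=> //; apply/reduced_word_cons.
Qed.

Lemma sorted_shift (p : seq nat) : sorted ltn p ->
  exists q, p = [seq i.+1 | i <- q] \/ p = 0%N :: [seq i.+1 | i <- q].
Proof.
have aux (r : seq nat) : all (leq 1) r -> r = [seq i.+1 | i <- [seq i.-1 | i <- r]].
  by elim: r => //= i r IHr /andP[i0 /IHr <-]; rewrite prednK.
case: p => [|[|i] p]; first by exists [::]; left.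
  rewrite /= path_sortedE; last exact: ltn_trans.
  by case/andP=> /aux pE _; exists [seq i.-1 | i <- p]; right; rewrite -pE.
rewrite /= path_sortedE; last exact: ltn_trans.
case/andP=> /allP ip _; exists [seq i.-1 | i <- i.+1 :: p]; left; apply: aux.
by apply/allP=> j; rewrite inE => /orP[/eqP ->//|/ip]; apply: leq_ltn_trans.
Qed.

Lemma exists_reduced_subword a w : perm_eq a (enum S) -> w \in W ->
  exists q, reduced_subword S a w q.
Proof.
move=> aS; rewrite -{1}(rd_gen rd) => /reduced_word_exists[b bw].
(* The [k]-th letter of the reduced word is taken from the [k]-th block. *)
pose pos := fix pos k (b : seq gT) :=
  if b is x :: b' then (k * size a + index x a)%N :: pos k.+1 b' else [::].
have ba : {subset b <= a}.
  by move=> x /(reduced_word_sub bw); rewrite (perm_mem aS) mem_enum.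
exists (pos 0%N b); split.
  have ge k d : all (leq (k * size a)) (pos k d).
    elim: d k => //= x d IHd k; rewrite leq_addr /=.
    by apply: sub_all (IHd k.+1) => i; apply: leq_trans; rewrite leq_mul.
  clear bw; elim: b 0%N ba => //= x b IHb k xba; rewrite path_sortedE; last exact: ltn_trans.
  rewrite IHb ?andbT => [|y yb]; last by apply: xba; rewrite inE yb orbT.
  apply: sub_all (ge k.+1 b) => i; apply: leq_trans.
  by rewrite mulSn addnC ltn_add2r index_mem xba ?mem_head.
suff -> : [seq letter_at a i | i <- pos 0%N b] = b by [].
clear bw; elim: b 0%N ba => //= x b IHb k xba; congr (_ :: _).
  rewrite /letter_at modnMDl modn_small ?index_mem ?nth_index // xba ?mem_head //.
by apply: IHb => y yb; apply: xba; rewrite inE yb orbT.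
Qed.

Lemma shift_le (q1 q2 : seq nat) :
  (([seq i.+1 | i <- q1] : seqlexi nat) <= [seq i.+1 | i <- q2])%O =
  ((q1 : seqlexi nat) <= q2)%O.
Proof. by elim: q1 q2 => [|i q1 IHq] [|j q2] //=; rewrite !lexi_cons IHq. Qed.

Lemma reduced_subword_size a w q : reduced_subword S a w q ->
  size q = cox_length S w.
Proof. by case=> _ /andP[_ /eqP <-]; rewrite size_map. Qed.

Definition nested_sorting a w p := sorting_positions S a w p /\ nested a p.

Lemma sortableE a w : uniq a -> sortable S a w <-> exists p, nested_sorting a w p.
Proof.
move=> ua; split=> [[p sp blk]|[p [sp nest]]].
  by exists p; split=> //; apply/block_nested.
by exists p => //; apply/block_nested.
Qed.

Lemma nested_sorting_inv s a w : perm_eq (s :: a) (enum S) -> w \in W -> inv w s ->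
  (exists p, nested_sorting (s :: a) w p) <->
  (exists q, nested_sorting (rcons a s) (s * w)%g q).
Proof.
move=> saS wW ws; have sS := first_simple saS; have sW := simple_mem sS.
have head0 p : reduced_subword S (s :: a) w p ->
    exists i p', p = i :: p'.
  by move/reduced_subword_size; rewrite (length_simple wW sS ws); case: p => // i p'; exists i, p'.
have szE : size (rcons a s) = size (s :: a) by rewrite size_rcons.
split=> [[p [[rp minp] nest]]|[q [[rq minq] nest]]].
  have [q0 rq0] := exists_reduced_subword (rot_perm saS) (groupM sW wW).
  have rq0' : reduced_subword S (s :: a) w (0%N :: [seq i.+1 | i <- q0]).
    exact/reduced_subword_cons0.
  have [q pE] := sorted_shift rp.1.
  (* Some reduced subword uses position 0, so the lexicographically first one does. *)
  have pE' : p = 0%N :: [seq i.+1 | i <- q].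
    case: pE => // pE; have := minp _ rq0'; have [i [p' pE']] := head0 _ rp.
    by case: q pE => [|j q] pE; move: pE'; rewrite pE //= lexi_cons.
  subst p; have /(reduced_subword_cons0 _ _ _ wW)[_ _ rq] := rp.
  exists q; split; first split=> // q1 rq1.
    have rq1' : reduced_subword S (s :: a) w (0%N :: [seq i.+1 | i <- q1]).
      exact/reduced_subword_cons0.
    by have := minp _ rq1'; rewrite lexi_cons lexx /= shift_le.
  move=> i; rewrite szE => iq; have := nest i.+1.
  by rewrite !inE /= addSn !mem_map; [apply|exact: succn_inj|exact: succn_inj].
exists (0%N :: [seq i.+1 | i <- q]); split; first split.
- exact/reduced_subword_cons0.
- move=> p1 rp1; have [i [p' pE']] := head0 _ rp1.
  have [q1 [] p1E] := sorted_shift rp1.1; rewrite p1E in rp1 pE' *.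
    by case: q1 pE' {rp1 p1E} => //= j q1 _; rewrite lexi_cons.
  have /(reduced_subword_cons0 _ _ _ wW)[_ _ rq1] := rp1.
  by rewrite lexi_cons lexx /= shift_le; exact: minq.
case=> [|i] //; rewrite !inE /= addSn !mem_map; [|exact: succn_inj|exact: succn_inj].
by have := nest i; rewrite szE.
Qed.

Lemma nested_sorting_ninv s a w : perm_eq (s :: a) (enum S) -> w \in W ->
  ~~ inv w s -> (exists p, nested_sorting (s :: a) w p) <->
  act w (wt s) = wt s /\ (exists q, nested_sorting (rcons a s) w q).
Proof.
move=> saS wW ws; have sS := first_simple saS; have sW := simple_mem sS.
have szE : size (rcons a s) = size (s :: a) by rewrite size_rcons.
have shiftP p : reduced_subword S (s :: a) w p -> exists q, p = [seq i.+1 | i <- q].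
  move=> rp; have [q [] pE] := sorted_shift rp.1; first by exists q.
  by move: rp; rewrite pE => /(reduced_subword_cons0 _ _ _ wW)[]; rewrite (negbTE ws).
split=> [[p [[rp minp] nest]]|[wfix [q [[rq minq] nest]]]].
  have [q pE] := shiftP _ rp; subst p; split.
    apply: (word_fix_wt sS rp.2); apply/negP=> /mapP[i ip sE].
    (* An occurrence of [s] sits at a multiple of the block length, and nestedness brings it down to
       position 0, which a shifted sequence omits. *)
    have i0 : i = 0%N %[mod size (s :: a)].
      apply: nth_uniq_letter => //; first by rewrite (perm_uniq saS) enum_uniq.
    have : (i %/ size (s :: a) * size (s :: a))%N \in [seq i.+1 | i <- q].
      by rewrite -[X in X \in _]addn0 -(mod0n (size (s :: a))) -i0 -divn_eq.
    move: (i %/ _)%N => k; elim: k => [|k IHk]; first by rewrite mul0n => /mapP[].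
    by rewrite mulSn addnC => /nest.
  have rq := (reduced_subword_shift s a w q).1 rp.
  exists q; split; first split=> // q1 rq1.
    by have := minp _ ((reduced_subword_shift s a w q1).2 rq1); rewrite shift_le.
  move=> i; rewrite szE => iq; have := nest i.+1.
  by rewrite addSn !mem_map; [apply|exact: succn_inj|exact: succn_inj].
have rp := (reduced_subword_shift s a w q).2 rq.
exists [seq i.+1 | i <- q]; split; first split=> //.
  move=> p1 rp1; have [q1 p1E] := shiftP _ rp1; subst p1.
  by rewrite shift_le; apply/minq/(reduced_subword_shift s a w q1).1.
(* At [i = 0] nestedness could fail only if position [size (s :: a)] were used; it carries [s],
   which no reduced word of [w] contains. *)
case=> [|i] ip; last first.
  move: ip; rewrite addSn !mem_map; [|exact: succn_inj|exact: succn_inj].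
  by have := nest i; rewrite szE.
case/negP: (fix_wt_word sS rp.2 wfix); apply/mapP; exists (0 + size (s :: a))%N => //.
by rewrite /letter_at add0n modnn.
Qed.

Lemma sortable_form_aligned a w : perm_eq a (enum S) -> w \in W ->
  sortable S a w <-> form_aligned a w.
Proof.
move=> aS wW; rewrite sortableE; last by rewrite (perm_uniq aS) enum_uniq.
move: a w aS wW; apply: sort_ind => [a aS|s a w saS wW ws IH|s a w saS wW ws _ IH].
- split=> [_ t t1 t2 x y tT _ _ _ _ _ _|_]; first by rewrite inv1.
  exists [::]; split=> //; split=> //; split=> //.
  by rewrite /reduced_word cox_length1 /word_for big_nil eqxx.
- by rewrite nested_sorting_inv // form_aligned_rot.
- by rewrite nested_sorting_ninv // form_aligned_ninv // IH.
Qed.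

(** * Linear independence of two roots *)

Lemma rt_prop t s (k : R) : t \in T -> s \in T -> rt t = k *: rt s -> t = s.
Proof.
move=> tT sT tE; apply: rt_eq_scale (tE) => //.
have := ht_gt0 tT; rewrite tE dotZl => k0; apply: ltW.
by rewrite -(pmulr_lgt0 _ (ht_gt0 sT)).
Qed.

Lemma rt_free t s (k l : R) : t \in T -> s \in T -> t != s ->
  k *: rt t + l *: rt s = 0 -> k = 0 /\ l = 0.
Proof.
move=> tT sT ts E.
have k0 : k = 0.
  apply/eqP/negPn/negP=> k0; case/eqP: ts; apply: (@rt_prop _ _ (- (l / k))) => //.
  move/eqP: E; rewrite addr_eq0 => /eqP E; apply: (scalerI k0); rewrite E.
  by rewrite scalerA mulrN mulrCA mulfV // mulr1 scaleNr.
split=> //; move: E; rewrite k0 scale0r add0r => /eqP.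
by rewrite scaler_eq0 (negbTE (rt_neq0 sT)) orbF => /eqP.
Qed.

Lemma omDr a u v z : om a z (u + v) = om a z u + om a z v.
Proof. by rewrite omC omDl (omC a z u) (omC a z v); ring. Qed.

Lemma omZr a (k : R) u v : om a v (k *: u) = k * om a v u.
Proof. by rewrite omC omZl (omC a v u); ring. Qed.

Lemma om_id a u : om a u u = 0.
Proof. by have := omC a u u; lra. Qed.

(** * Planes spanned by two roots *)

Definition in_plane t1 t2 t := exists x y : R, rt t = x *: rt t1 + y *: rt t2.

(** Canonical generators in terms of roots alone, without regions; [canonical_generatorsP] relates
    the two. *)
Definition cone_generators (A : {set gT}) t1 t2 :=
  [/\ t1 \in A, t2 \in A, t1 != t2 &
      forall t, t \in A -> exists x y : R,
        [/\ 0 <= x, 0 <= y & rt t = x *: rt t1 + y *: rt t2]].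

Lemma cone_generatorsC (A : {set gT}) t1 t2 :
  cone_generators A t1 t2 -> cone_generators A t2 t1.
Proof.
case=> At1 At2 t12 cone; split; rewrite 1?eq_sym // => t /cone[x [y [x0 y0 tE]]].
by exists y, x; rewrite addrC.
Qed.

Lemma cone_generators_conj (P : {group gT}) s t1 t2 : s \in S -> s \notin P ->
  cone_generators (T :&: P) t1 t2 ->
  cone_generators (T :&: (P :^ s)%g) (t1 ^ s)%g (t2 ^ s)%g.
Proof.
move=> sS sP [+ + t12 cone]; rewrite !inE => /andP[t1T t1P] /andP[t2T t2P].
have sW := simple_mem sS.
have ns t : t \in P -> t != s by apply: contraTneq => ->.
split; rewrite ?inE ?memJ_conjg ?reflJ ?(inj_eq (conjg_inj s)) ?t1P ?t2P //.
move=> t; rewrite inE mem_conjg (simpleV sS) => /andP[tT tP].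
have tsT : (t ^ s)%g \in T by exact: reflJ.
have [|x [y [x0 y0 tE]]] := cone (t ^ s)%g; first by rewrite inE tsT.
exists x, y; split=> //; rewrite -!act_simple_rt ?ns // -!(rd_actZ rd) -(rd_actD rd).
by rewrite -tE act_simple_rt ?ns // conjg_simpleK.
Qed.

Lemma cone_generators_simple (A : {set gT}) s t1 t2 : A \subset T -> s \in S ->
  s \in A -> cone_generators A t1 t2 -> s = t1 \/ s = t2.
Proof.
move=> /fintype.subsetP AT sS sA [/AT t1T /AT t2T t12 cone].
have [x [y [x0 y0 sE]]] := cone s sA.
have sT := simple_refl sS.
move: x0; rewrite le_eqVlt => /orP[/eqP x0|x0].
  right; apply: (@rt_prop _ _ y) => //.
  by rewrite sE -x0 scale0r add0r.
move: y0; rewrite le_eqVlt => /orP[/eqP y0|y0].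
  left; apply: (@rt_prop _ _ x) => //.
  by rewrite sE -y0 scale0r addr0.
by left; have [-> _] := simple_indecomposable sS t1T t2T x0 y0 sE.
Qed.

Lemma exists_notin (B : seq R) : exists e, e \notin B.
Proof.
exists (1 + \sum_(b <- B) `|b|); apply/negP=> eB.
have le (b : R) : b \in B -> `|b| <= \sum_(c <- B) `|c|.
  move=> bB; rewrite (perm_big _ (perm_to_rem bB)) big_cons lerDl.
  by apply: sumr_ge0 => i _; exact: normr_ge0.
have := le _ eB; have : 0 <= \sum_(c <- B) `|c| by apply: sumr_ge0 => i _; exact: normr_ge0.
move: (\sum_(c <- B) _) => z z0; rewrite ger0_norm; last by lra.
by lra.
Qed.

(** A vector [u] good for the earlier functionals is perturbed along a [z] that the new one does not
    kill; only finitely many factors [e] are forbidden. *)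
Lemma exists_generic (U : V -> Prop) (L : seq V) :
  U 0 -> (forall k u v, U u -> U v -> U (u + k *: v)) ->
  {in L, forall l, exists2 z, U z & dot l z != 0} ->
  exists2 u, U u & {in L, forall l, dot l u != 0}.
Proof.
move=> U0 UD; elim: L => [_|l L IHL Ll]; first by exists 0.
have [l' l'L|u Uu uL] := IHL; first by apply: Ll; rewrite inE l'L orbT.
have [z Uz lz] := Ll l (mem_head _ _).
have [lu|lu] := eqVneq (dot l u) 0; last first.
  by exists u => // l'; rewrite inE => /orP[/eqP ->//|/uL].
have [e] := exists_notin (0 :: [seq - dot l' u / dot l' z | l' <- L]).
rewrite inE negb_or => /andP[e0 eL].
exists (u + e *: z); first exact: UD.
move=> l'; rewrite inE => /orP[/eqP ->|l'L]; rewrite !dotE.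
  by rewrite lu add0r mulf_neq0.
apply: contra eL => /eqP E; apply/mapP; exists l' => //.
have [z0|z0] := eqVneq (dot l' z) 0.
  by move: E; rewrite z0 mulr0 addr0 => /eqP; rewrite (negbTE (uL _ l'L)).
by apply: (mulIf z0); rewrite mulfVK //; lra.
Qed.

Lemma off_plane_orth t1 t2 t : t1 \in T -> t2 \in T -> t1 != t2 ->
  ~ in_plane t1 t2 t ->
  exists2 z, dot (rt t1) z = 0 /\ dot (rt t2) z = 0 & dot (rt t) z != 0.
Proof.
move=> t1T t2T t12 nt; set e1 := rt t1; set e2 := rt t2; set v := rt t.
have e11 : dot e1 e1 = 1 by exact: rd_rt_unit rd _ _.
have [f [fe1 f0 e2E]] : exists f,
    [/\ dot e1 f = 0, dot f f != 0 & e2 = f + dot e1 e2 *: e1].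
  exists (e2 - dot e1 e2 *: e1); split; last by rewrite subrK.
    by rewrite !dotE e11; ring.
  apply/eqP=> /(rd_dot_eq0 rd) /eqP; rewrite subr_eq0 => /eqP E.
  by move: t12; rewrite (rt_prop t2T t1T E) eqxx.
(* Gram-Schmidt: [f] is [e2] made orthogonal to [e1], and [z] is the component of [v] orthogonal to
   both. *)
pose m := dot v f / dot f f; pose z := v - dot v e1 *: e1 - m *: f.
have ze1 : dot e1 z = 0 by rewrite /z !dotE e11 fe1 (dotC e1 v); ring.
have zf : dot f z = 0.
  by rewrite /z !dotE (dotC f e1) fe1 (dotC f v) /m mulfVK //; ring.
have ze2 : dot e2 z = 0 by rewrite e2E dotDl dotZl zf ze1; ring.
exists z => //; apply/eqP=> vz; apply: nt.
have z0 : z = 0.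
  by apply: (rd_dot_eq0 rd); rewrite {1}/z !dotDl !dotNl !dotZl vz ze1 zf; ring.
exists (dot v e1 - m * dot e1 e2), m.
move/eqP: z0; rewrite /z -addrA -opprD subr_eq0 => /eqP; rewrite -/e1 -/e2 -/v => vE.
transitivity (dot v e1 *: e1 + m *: f); first exact: vE.
have -> : m *: e2 = m *: f + (m * dot e1 e2) *: e1 by rewrite {1}e2E scalerDr scalerA.
by rewrite scalerBl addrACA addNr addr0.
Qed.

(** Take the vector of the orbit with the largest product with [rho]: reflecting in a simple root
    negative on it would increase that product. *)
Lemma exists_dominant v : exists2 g, g \in W &
  forall s, s \in S -> 0 <= dot (rt s) (act g v).
Proof.
have [g gW gmax] : exists2 g, g \in W &
    forall h, h \in W -> dot (act h v) rho <= dot (act g v) rho.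
  case: (@arg_maxP _ _ _ 1%g [in W] (fun h => dot (act h v) rho)).
    exact: group1.
  by move=> g gW gmax; exists g => // h /gmax.
exists g => // s sS; have sW := simple_mem sS; have sT := simple_refl sS.
have := gmax (s * g)%g; rewrite groupM // => /(_ isT).
rewrite (rd_actM rd) // (rd_act_refl rd _ sT) !dotE (dotC (act g v) (rt s)) => le.
rewrite -(pmulr_lge0 _ (ht_gt0 sT)).
by move: le; rewrite -mulrA; lra.
Qed.

(** * Stabilizer of a dominant vector *)

Section Dominant.

Variable u : V.
Hypothesis u_dom : forall s, s \in S -> 0 <= dot (rt s) u.

Definition orth_simple : {set gT} := [set s in S | dot (rt s) u == 0].

Lemma orth_supp t s : t \in T -> dot (rt t) u = 0 -> s \in S ->
  s \notin orth_simple -> coor (rt t) s = 0.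
Proof.
move=> tT tu sS; rewrite inE sS /= => su; apply/eqP.
have /eqP : dot (\sum_(r in S) coor (rt t) r *: rt r) u = 0 by rewrite -(rd_expand rd tT).
rewrite dot_suml psumr_eq0; last first.
  by move=> r rS; rewrite dotZl mulr_ge0 ?(rd_ge0 rd) ?u_dom.
move/allP/(_ s); rewrite mem_index_enum sS => /(_ isT) /=.
by rewrite dotZl mulf_eq0 (negbTE su) orbF.
Qed.

Lemma orth_expand t : t \in T -> dot (rt t) u = 0 ->
  rt t = \sum_(s in orth_simple) coor (rt t) s *: rt s.
Proof.
move=> tT tu; rewrite {1}(rd_expand rd tT) (bigID (mem orth_simple)) /=.
rewrite [X in _ + X]big1 ?addr0 => [|s /andP[sS sJ]]; last first.
  by rewrite orth_supp // scale0r.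
by apply: eq_bigl => s; rewrite inE; case: (s \in S).
Qed.

(** Conjugation by a suitable [r] in [orth_simple] lowers the height of the root until it is simple.
    Some [r] has positive product with it, as otherwise the expansion of [rt t] over [orth_simple]
    would give it a nonpositive norm. *)
Lemma orth_mem_gen t : t \in T -> dot (rt t) u = 0 -> t \in <<orth_simple>>%g.
Proof.
pose below t := [set t' in T | dot (rt t') rho < dot (rt t) rho].
have [m] := ubnP #|below t|; elim: m t => // m IHm t; rewrite ltnS => lt_m tT tu.
have [r rJ tr] : exists2 r, r \in orth_simple & 0 < dot (rt t) (rt r).
  have [//|no] := pselect (exists2 r, r \in orth_simple & 0 < dot (rt t) (rt r)).
  have := rd_rt_unit rd tT; rewrite {2}(orth_expand tT tu) dot_sumr => E.
  suff : \sum_(s in orth_simple) dot (rt t) (coor (rt t) s *: rt s) <= 0.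
    by rewrite E; lra.
  apply: sumr_le0 => s sJ; rewrite dotZr mulr_ge0_le0 //.
    by apply: (rd_ge0 rd) => //; move: sJ; rewrite inE => /andP[].
  by rewrite leNgt; apply/negP=> ts; apply: no; exists s.
have [<-|tnr] := eqVneq r t; first exact: mem_gen.
have /andP[rS /eqP ru] : (r \in S) && (dot (rt r) u == 0) by move: rJ; rewrite inE.
have rW := simple_mem rS; have rT := simple_refl rS.
have trT : (t ^ r)%g \in T by exact: reflJ.
have trE : rt (t ^ r)%g = rt t - (2 * dot (rt t) (rt r)) *: rt r.
  by rewrite -act_simple_rt // 1?eq_sym // (rd_act_refl rd).
have lt_tr : dot (rt (t ^ r)%g) rho < dot (rt t) rho.
  rewrite trE !dotE; have := ht_gt0 rT; nra.
have : (t ^ r)%g \in <<orth_simple>>%g.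
  apply: IHm => //; last by rewrite trE !dotE tu ru; ring.
  apply: leq_trans lt_m; apply: proper_card; apply/properP; split.
    apply/fintype.subsetP=> x; rewrite !inE => /andP[-> /= xt]; exact: lt_trans lt_tr.
  by exists (t ^ r)%g; rewrite !inE trT ?ltxx ?lt_tr.
by move=> mem; rewrite -(conjg_simpleK t rS) groupJ // mem_gen.
Qed.

Lemma gen_orth_fix h : h \in <<orth_simple>>%g -> act h u = u.
Proof.
case/word_for_exists=> b /andP[/allP bJ /eqP <-]; elim: b bJ => [|r b IHb] bJ.
  by rewrite big_nil (rd_act1 rd).
have bS x : x \in r :: b -> x \in W.
  by move/bJ; rewrite inE => /andP[/simple_mem].
have /andP[rS /eqP ru] : (r \in S) && (dot (rt r) u == 0).
  by have := bJ r (mem_head _ _); rewrite inE.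
have rW : r \in W by exact: simple_mem.
rewrite big_cons (rd_actM rd) // ?IHb; last first.
- by rewrite big_seq group_prod // => x xb; apply: bS; rewrite inE xb orbT.
- by move=> x xb; apply: bJ; rewrite inE xb orbT.
by rewrite (rd_act_refl rd) ?simple_refl // dotC ru mulr0 scale0r subr0.
Qed.

Lemma orth_refl_gen t : t \in T -> t \in <<orth_simple>>%g -> dot (rt t) u = 0.
Proof.
move=> tT /gen_orth_fix; rewrite (rd_act_refl rd _ tT) => /eqP.
rewrite -subr_eq0 addrAC subrr add0r oppr_eq0 scaler_eq0 (negbTE (rt_neq0 tT)) orbF.
by rewrite mulf_eq0 pnatr_eq0 /= dotC => /eqP.
Qed.

End Dominant.

(* A 3 x 2 times a 2 x 3 matrix is not the identity. *)
Lemma rank2_identity (x1 y1 x2 y2 x3 y3 a1 b1 a2 b2 a3 b3 : R) :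
  1 = x1 * a1 + y1 * b1 -> 0 = x1 * a2 + y1 * b2 -> 0 = x1 * a3 + y1 * b3 ->
  0 = x2 * a1 + y2 * b1 -> 1 = x2 * a2 + y2 * b2 -> 0 = x2 * a3 + y2 * b3 ->
  1 = x3 * a3 + y3 * b3 -> False.
Proof.
move=> F11 F12 F13 F21 F22 F23 F33.
have K : (x1 * y2 - x2 * y1) * (x3 * a3 + y3 * b3) =
    (x1 * a3 + y1 * b3) * (x3 * y2 - x2 * y3) + (x2 * a3 + y2 * b3) * (x1 * y3 - x3 * y1).
  by ring.
have K2 : (x1 * y2 - x2 * y1) * (a1 * b2 - a2 * b1) =
    (x1 * a1 + y1 * b1) * (x2 * a2 + y2 * b2) - (x1 * a2 + y1 * b2) * (x2 * a1 + y2 * b1).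
  by ring.
move: K K2; rewrite -F33 -F13 -F23 -F11 -F22 -F12 -F21 => K K2.
have D0 : x1 * y2 - x2 * y1 = 0 by lra.
by move: K2; rewrite D0; lra.
Qed.

(** The roots orthogonal to a generic vector of the orthogonal complement are exactly those of the
    plane. Once this vector is moved to a dominant [u], they belong to the subgroup generated by
    [orth_simple u], which has two elements because its roots form a basis of the moved plane. *)
Lemma plane_parabolic t1 t2 : t1 \in T -> t2 \in T -> t1 != t2 ->
  exists2 P : {group gT}, rank2_parabolic W S P &
    forall t, t \in T -> t \in P <-> in_plane t1 t2 t.
Proof.
move=> t1T t2T t12.
pose L := [seq rt t | t <- enum T & ~~ `[< in_plane t1 t2 t >]].
have [| | |v0 [v01 v02] v0L] := @exists_generic
    (fun v => dot (rt t1) v = 0 /\ dot (rt t2) v = 0) L.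
- by rewrite !dot0r.
- by move=> k u v [u1 u2] [v1 v2]; rewrite !dotE u1 u2 v1 v2; split; ring.
- move=> _ /mapP[t + ->]; rewrite mem_filter mem_enum => /andP[/asboolPn nt tT].
  exact: off_plane_orth.
have v0P t : t \in T -> dot (rt t) v0 = 0 <-> in_plane t1 t2 t.
  move=> tT; split=> [tv|[x [y ->]]]; last by rewrite !dotE v01 v02; ring.
  have [//|nt] := pselect (in_plane t1 t2 t).
  have := v0L (rt t); rewrite tv eqxx => /(_ _)/notF; case.
  by apply/mapP; exists t => //; rewrite mem_filter mem_enum tT andbT; apply/asboolPn.
have [g gW g_dom] := exists_dominant v0.
pose u := act g v0; pose J := orth_simple u.
have JS : J \subset S by apply/fintype.subsetP=> s; rewrite inE => /andP[].
have gVW := groupVr gW.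
have conjE t : t \in T -> dot (rt t) u = 0 <-> dot (rt (t ^ g)%g) v0 = 0.
  move=> tT; have := dot_actl (rt t) v0 gVW; rewrite invgK -/u => <-.
  have [|] := rd_act_rt rd gVW tT; rewrite invgK => -> //.
  by rewrite dotNl; split=> /eqP; rewrite ?oppr_eq0 => /eqP // ->; rewrite oppr0.
exists (<<J>> :^ g)%G; last first.
  move=> t tT; rewrite mem_conjg -v0P //.
  have tgT : (t ^ g^-1)%g \in T by exact: reflJ.
  rewrite -[t in dot (rt t) v0](conjgKV g) -conjE //; split.
    exact: orth_refl_gen.
  exact: orth_mem_gen.
exists J, g => //; split=> //.
have E_neq0 (k l : R) : k *: act g (rt t1) + l *: act g (rt t2) = 0 -> k = 0 /\ l = 0.
  rewrite -!(rd_actZ rd) -(rd_actD rd) => /(congr1 (act g^-1%g)).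
  rewrite actK // => E; apply: (rt_free t1T t2T t12); by rewrite E act0.
have J_span r : r \in J -> exists x y : R,
    rt r = x *: act g (rt t1) + y *: act g (rt t2).
  rewrite inE => /andP[rS /eqP ru]; have rT := simple_refl rS.
  have /v0P[|x [y E]] := (conjE r rT).1 ru; first exact: reflJ.
  have rE : act g (rt (r ^ g)%g) = rt r \/ act g (rt (r ^ g)%g) = - rt r.
    by have := rd_act_rt rd gW (reflJ rT gW); rewrite conjgK.
  rewrite E (rd_actD rd) !(rd_actZ rd) in rE.
  case: rE => rE; first by exists x, y.
  by exists (- x), (- y); rewrite !scaleNr -opprD rE opprK.
have E_span t : t \in T -> dot (rt t) v0 = 0 ->
    act g (rt t) = \sum_(s in J) coor (act g (rt t)) s *: rt s.
  move=> tT tv; have tgT : (t ^ g^-1)%g \in T by apply: reflJ.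
  have tu : dot (rt (t ^ g^-1)%g) u = 0 by apply/conjE; rewrite ?conjgKV.
  have [->|->] := rd_act_rt rd gW tT; first exact: orth_expand.
  by rewrite {1}(orth_expand g_dom tgT tu) -sumrN; apply: eq_bigr => s _; rewrite dotNl scaleNr.
apply/eqP; rewrite eqn_leq; apply/andP; split; rewrite leqNgt; apply/negP.
  case/card_gt2P=> r1 [r2 [r3 [[r1J r2J r3J] [r12 r23 r31]]]].
  have [x1 [y1 E1]] := J_span _ r1J; have [x2 [y2 E2]] := J_span _ r2J.
  have [x3 [y3 E3]] := J_span _ r3J.
  have JJ r r' : r \in J -> r' \in J -> coor (rt r) r' = (r == r')%:R.
    by rewrite !inE => /andP[rS _] /andP[r'S _]; rewrite (rd_dual rd).
  pose A1 z := dot (act g (rt t1)) z; pose A2 z := dot (act g (rt t2)) z.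
  have D1 z : dot (rt r1) z = x1 * A1 z + y1 * A2 z by rewrite E1 !dotE.
  have D2 z : dot (rt r2) z = x2 * A1 z + y2 * A2 z by rewrite E2 !dotE.
  have D3 z : dot (rt r3) z = x3 * A1 z + y3 * A2 z by rewrite E3 !dotE.
  have := D1 (wt r1); have := D2 (wt r1); have := D3 (wt r1).
  have := D1 (wt r2); have := D2 (wt r2); have := D3 (wt r2).
  have := D1 (wt r3); have := D2 (wt r3); have := D3 (wt r3).
  rewrite !JJ // !eqxx (negbTE r12) (negbTE r23) (negbTE r31).
  rewrite (eq_sym r2 r1) (eq_sym r3 r2) (eq_sym r1 r3).
  rewrite (negbTE r12) (negbTE r23) (negbTE r31) !mulr1n !mulr0n.
  move: (A1 (wt r1)) (A2 (wt r1)) (A1 (wt r2)) (A2 (wt r2)) (A1 (wt r3)) (A2 (wt r3)).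
  clear; move=> a1 b1 a2 b2 a3 b3 F33 F23 F13 F32 F22 F12 F31 F21 F11.
  exact: (rank2_identity F11 F12 F13 F21 F22 F23 F33).
have n0 t : t \in T -> act g (rt t) != 0.
  move=> tT; apply: contra (rt_neq0 tT) => /eqP E; rewrite -(actK (rt t) gW) E.
  by rewrite act0.
rewrite ltnS leq_eqVlt ltnS leqn0 => /orP[/cards1P[r JE]|/eqP/cards0_eq JE].
  have E1 := E_span _ t1T v01; have E2 := E_span _ t2T v02.
  rewrite JE !big_set1 in E1 E2.
  have [|k0 _] := E_neq0 (coor (act g (rt t2)) r) (- coor (act g (rt t1)) r).
    by rewrite E1 E2 !dotE scaleNr !scalerA; apply/eqP; rewrite subr_eq0; apply/eqP; congr (_ *: _); ring.
  by move: (n0 _ t2T); rewrite E2 k0 scale0r eqxx.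
by have := E_span _ t1T v01; rewrite JE big_set0 => /eqP; rewrite (negbTE (n0 _ t1T)).
Qed.

Definition generator_aligned (o : rel gT) w : Prop := forall (P : {group gT}) t1 t2,
  irr_rank2_parabolic W S P -> cone_generators (T :&: P) t1 t2 -> o t1 t2 ->
  inv w (t1 ^ t2)%g -> inv w t1.

(** Up to sign, the root of [t1 ^ t2] is [rt t1 - 2 d rt t2] with [d] the product of the two roots.
    It lies in the cone, so its coefficient at [t1] forces the plus sign, and the one at [t2] forces
    [d] to be nonpositive. *)
Lemma cone_reflect (P : {group gT}) t1 t2 : cone_generators (T :&: P) t1 t2 ->
  [/\ (t1 ^ t2)%g \in T :&: P, dot (rt t1) (rt t2) <= 0 &
    rt (t1 ^ t2)%g = rt t1 - (2 * dot (rt t1) (rt t2)) *: rt t2].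
Proof.
case=> + + t12 cone; rewrite !inE => /andP[t1T t1P] /andP[t2T t2P].
have t2W := refl_mem t2T.
have tT : (t1 ^ t2)%g \in T by exact: reflJ.
have [|x [y [x0 y0 tE]]] := cone (t1 ^ t2)%g; first by rewrite inE tT groupJ.
have := rd_act_rt rd t2W t1T; rewrite (rd_act_refl rd _ t2T) reflV // => E.
rewrite tT groupJ // tE.
case: E => E.
  split=> //; last by rewrite E.
  have [] := @rt_free t1 t2 (x - 1) (y + 2 * dot (rt t1) (rt t2)) t1T t2T t12; last by lra.
  rewrite scalerBl scalerDl scale1r addrACA -tE -E addrACA subrr add0r.
  by rewrite addNr.
have [] := @rt_free t1 t2 (x + 1) (y - 2 * dot (rt t1) (rt t2)) t1T t2T t12; last by lra.
by rewrite scalerBl scalerDl scale1r addrACA -tE E addrN.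
Qed.

(** * Alignment on generators and on all roots of a plane *)

Section Orient.

Variables (o : rel gT) (a : seq gT).
Hypothesis oP : forall (P : {group gT}) t1 t2, irr_rank2_parabolic W S P ->
  cone_generators (T :&: P) t1 t2 -> o t1 t2 <-> 0 < om a (rt t1) (rt t2).

Lemma form_generator_aligned w : form_aligned a w -> generator_aligned o w.
Proof.
move=> al P t1 t2 irrP cone /(oP irrP cone) o12.
have [] := cone_reflect cone; rewrite inE => /andP[tT _] d0 tE.
have [+ + _ _] := cone; rewrite !inE => /andP[t1T _] /andP[t2T _].
move: d0; rewrite le_eqVlt => /orP[/eqP d0|d0].
  have -> // : (t1 ^ t2)%g = t1.
  by apply: (rd_rt_inj rd) => //; rewrite tE d0 mulr0 scale0r subr0.
apply: (al (t1 ^ t2)%g t1 t2 1 (- (2 * dot (rt t1) (rt t2)))) => //; first by lra.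
by rewrite scale1r scaleNr.
Qed.

Hypothesis coneP : forall (P : {group gT}) t1 t2, t1 \in T :&: P ->
  t2 \in T :&: P -> t1 != t2 -> (forall t, t \in T :&: P -> in_plane t1 t2 t) ->
  exists d1 d2, cone_generators (T :&: P) d1 d2.

Lemma commute_orth t t' : t \in T -> t' \in T -> t != t' -> (t ^ t' = t)%g ->
  dot (rt t) (rt t') = 0.
Proof.
move=> tT t'T tt' E; have := rd_act_rt rd (refl_mem t'T) tT.
rewrite (rd_act_refl rd _ t'T) reflV // E; set d := dot _ _ => -[] H.
  have [|_] := @rt_free t t' 0 (2 * d) tT t'T tt'; last by lra.
  by move/eqP: H; rewrite scale0r add0r -subr_eq0 addrAC subrr add0r oppr_eq0 => /eqP.
have [|] := @rt_free t t' 2 (- (2 * d)) tT t'T tt'; last by lra.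
move/eqP: H; rewrite -subr_eq0 opprK addrAC => /eqP <-.
by rewrite scaleNr scaler_nat mulr2n.
Qed.

(** In an abelian [P], [t] would commute with [t1] and [t2], so [rt t] would be orthogonal to both
    and then to itself. *)
Lemma plane_irreducible (P : {group gT}) t t1 t2 (x y : R) : rank2_parabolic W S P ->
  t \in T -> t1 \in T -> t2 \in T -> t \in P -> t1 \in P -> t2 \in P ->
  t1 != t2 -> 0 < x -> 0 < y -> rt t = x *: rt t1 + y *: rt t2 ->
  irr_rank2_parabolic W S P.
Proof.
move=> par tT t1T t2T tP t1P t2P t12 x0 y0 tE; split=> //.
apply/negP=> abP.
have com t' : t' \in P -> (t ^ t' = t)%g.
  by move=> t'P; apply/conjg_fixP/commgP; exact: (centsP abP).
have n1 : t != t1.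
  apply/eqP=> tt1; have [|_ y00] := @rt_free t1 t2 (x - 1) y t1T t2T t12; last by lra.
  by rewrite scalerBl scale1r addrAC -tE tt1 subrr.
have n2 : t != t2.
  apply/eqP=> tt2; have [|x00 _] := @rt_free t1 t2 x (y - 1) t1T t2T t12; last by lra.
  by rewrite scalerBl scale1r addrA -tE tt2 subrr.
have := rd_rt_unit rd tT; rewrite {2}tE !dotE.
by rewrite !commute_orth ?com //; lra.
Qed.

(** Let [d1], [d2] generate the plane with [om] positive on them. If [t] is an inversion and [t1] is
    not, then [d1] is not one, and by alignment neither is [d1 ^ d2]. This places [rt t] strictly
    between the roots of [d1 ^ d2] and [d2], where no root lies: reflecting by [d2] would give it
    coefficients of opposite signs. *)
Lemma generator_form_aligned w : w \in W -> generator_aligned o w -> form_aligned a w.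
Proof.
move=> wW al t t1 t2 x y tT t1T t2T x0 y0 tE o12 wt_.
have t12 : t1 != t2 by apply: contraTneq o12 => ->; rewrite om_id ltxx.
have [P par Pin] := plane_parabolic t1T t2T t12.
have t1P : t1 \in P by apply/(Pin _ t1T); exists 1, 0; rewrite scale1r scale0r addr0.
have t2P : t2 \in P by apply/(Pin _ t2T); exists 0, 1; rewrite scale1r scale0r add0r.
have tP : t \in P by apply/(Pin _ tT); exists x, y.
have irrP := plane_irreducible par tT t1T t2T tP t1P t2P t12 x0 y0 tE.
have t1A : t1 \in T :&: P by rewrite inE t1T.
have t2A : t2 \in T :&: P by rewrite inE t2T.
have [|d1 [d2 cone]] := coneP t1A t2A t12.
  by move=> t'; rewrite inE => /andP[t'T t'P]; apply/Pin.
wlog od : d1 d2 cone / 0 < om a (rt d1) (rt d2).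
  move=> gen; have [od|od|od] := ltgtP 0 (om a (rt d1) (rt d2)); first exact: gen cone od.
    by apply: (gen d2 d1); [exact: cone_generatorsC|rewrite omC oppr_gt0].
  (* If [om] vanished on [d1] and [d2], it would vanish on the whole plane. *)
  have [_ _ _ cone2] := cone.
  have [|x1 [y1 [_ _ E1]]] := cone2 t1; first by rewrite inE t1T.
  have [|x2 [y2 [_ _ E2]]] := cone2 t2; first by rewrite inE t2T.
  move: o12; rewrite E1 E2 !(omDl, omDr, omZl, omZr) !om_id (omC a (rt d1) (rt d2)) -od.
  by rewrite oppr0 !mulr0 !addr0 ltxx.
have ald := al P d1 d2 irrP cone ((oP irrP cone).2 od).
have [] := cone_reflect cone; rewrite inE => /andP[dT _] db dE.
have [d1A d2A d12 cone2] := cone.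
move: d1A d2A; rewrite !inE => /andP[d1T d1P] /andP[d2T d2P].
have [|x1 [y1 [x10 y10 E1]]] := cone2 t1; first by rewrite inE t1T.
have [|x2 [y2 [x20 y20 E2]]] := cone2 t2; first by rewrite inE t2T.
(* As [om] is alternating, [t1] and [t2] are ordered in the plane like [d1] and [d2]. *)
have det : 0 < x1 * y2 - x2 * y1.
  suff omE : om a (rt t1) (rt t2) = (x1 * y2 - x2 * y1) * om a (rt d1) (rt d2).
    by move: o12; rewrite omE pmulr_lgt0.
  by rewrite E1 E2 !(omDl, omDr, omZl, omZr) !om_id (omC a (rt d1) (rt d2)); ring.
pose p := x * x1 + y * x2; pose q := x * y1 + y * y2.
have tE' : rt t = p *: rt d1 + q *: rt d2.
  rewrite tE E1 E2 !scalerDr !scalerA addrACA -!scalerDl //.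
set f := fun v => dot v (act w rho).
have p0 : 0 < p.
  by rewrite /p; have [x1p|x1z] := ltP 0 x1; nra.
apply/negPn/negP=> nt1.
have f1 : 0 < x1 * f (rt d1) + y1 * f (rt d2).
  by move: nt1; rewrite invN // E1 !dotE.
have ft : p * f (rt d1) + q * f (rt d2) < 0 by move: wt_; rewrite /inv tE' !dotE.
have ft2 : x2 * f (rt d1) + y2 * f (rt d2) < 0.
  suff : x * (x1 * f (rt d1) + y1 * f (rt d2)) + y * (x2 * f (rt d1) + y2 * f (rt d2)) < 0.
    by have := mulr_gt0 x0 f1; nra.
  by move: ft; rewrite /p /q; lra.
have fd1 : 0 < f (rt d1).
  rewrite ltNge; apply/negP=> fd1.
  have fd2 : 0 < f (rt d2) by nra.
  nra.
have nd1 : ~~ inv w d1 by rewrite invN.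
have : ~~ inv w (d1 ^ d2)%g by apply: contra nd1; exact: ald.
rewrite invN // dE !dotE -/(f (rt d1)) -/(f (rt d2)); set b := dot (rt d1) (rt d2) in db dE *.
move=> fd.
have fd2 : f (rt d2) < 0.
  rewrite ltNge; apply/negP=> fd2.
  have q0 : 0 <= q by rewrite /q addr_ge0 // mulr_ge0 // ltW.
  by have := mulr_gt0 p0 fd1; have := mulr_ge0 q0 fd2; lra.
have lt_q : - (2 * b) * p < q by nra.
have := rd_act_rt rd (refl_mem d2T) tT; rewrite (rd_act_refl rd _ d2T) reflV //.
have tdA : (t ^ d2)%g \in T :&: P by rewrite inE reflJ ?refl_mem // groupJ.
have [x3 [y3 [x30 y30 E3]]] := cone2 _ tdA.
rewrite E3 tE' !dotE (rd_rt_unit rd) // -/b.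
have -> : p *: rt d1 + q *: rt d2 - (2 * (p * b + q * 1)) *: rt d2 =
    p *: rt d1 + (- (q + 2 * b * p)) *: rt d2.
  by rewrite -addrA -scalerBl; congr (_ + _ *: _); ring.
have : - (q + 2 * b * p) < 0 by lra.
move: (- (q + 2 * b * p)) => m m0 [] /eqP; rewrite -subr_eq0.
  by rewrite opprD addrACA -!scalerBl => /eqP/(rt_free d1T d2T d12)[]; lra.
by rewrite opprK addrACA -!scalerDl => /eqP/(rt_free d1T d2T d12)[]; lra.
Qed.

End Orient.

(** * The c-orientation *)

Section OrientationFamily.

Variable o : gT -> rel gT.
Hypothesis o_first : forall s a (P : {group gT}) t, perm_eq (s :: a) (enum S) ->
  irr_rank2_parabolic W S P -> cone_generators (T :&: P) s t ->
  o (\prod_(r <- s :: a) r)%g s t.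
Hypothesis o_rot : forall s a t1 t2, perm_eq (s :: a) (enum S) ->
  o (\prod_(r <- s :: a) r)%g t1 t2 ->
  o (\prod_(r <- rcons a s) r)%g (t1 ^ s)%g (t2 ^ s)%g.

(* [(a, g)] stands for the word [a] reached after conjugation by [g]; the period
   of this rotation turns the forward rule [o_rot] into an equivalence. *)
Definition cstep (x : seq gT * gT) : seq gT * gT :=
  if x.1 is s :: a then (rcons a s, x.2 * s)%g else x.

Definition arrow_at t1 t2 (x : seq gT * gT) : bool :=
  o (\prod_(r <- x.1) r)%g (t1 ^ x.2)%g (t2 ^ x.2)%g.

Lemma cstep_mul k a g : iter k cstep (a, g) =
  ((iter k cstep (a, 1%g)).1, g * (iter k cstep (a, 1%g)).2)%g.
Proof.
elim: k => [|k IHk] /=; first by rewrite mulg1.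
rewrite IHk /cstep /=; case: (iter k cstep (a, 1%g)) => -[|s b] h //=.
by rewrite mulgA.
Qed.

Lemma cstep_cat b d g : iter (size b) cstep (b ++ d, g) =
  (d ++ b, g * \prod_(r <- b) r)%g.
Proof.
elim: b d g => [|s b IHb] d g; first by rewrite /= big_nil mulg1 cats0.
rewrite [size _]/= iterSr.
have -> : cstep ((s :: b) ++ d, g) = (b ++ rcons d s, g * s)%g.
  by rewrite /cstep /= rcons_cat.
by rewrite IHb cat_rcons big_cons mulgA.
Qed.

(** A full turn of the word multiplies the group component by the Coxeter element, so as many turns
    as its order lead back to the start. *)
Lemma cstep_period a k : iter (k * (size a * #[\prod_(r <- a) r]%g))%N cstep (a, 1%g) =
  (a, 1%g).
Proof.
set c := (\prod_(r <- a) r)%g.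
have one g : iter (size a) cstep (a, g) = (a, g * c)%g.
  by rewrite -{2}[a]cats0 cstep_cat.
have many m g : iter (size a * m) cstep (a, g) = (a, g * c ^+ m)%g.
  elim: m g => [|m IHm] g; first by rewrite muln0 expg0 mulg1.
  by rewrite mulnSr addnC iterD IHm one expgSr mulgA.
elim: k => [|k IHk]; first by rewrite mul0n.
by rewrite mulSn iterD IHk many expg_order mulg1.
Qed.

Lemma cstep_perm k a g : perm_eq a (enum S) ->
  perm_eq (iter k cstep (a, g)).1 (enum S).
Proof.
move=> aS; elim: k => //= k; case: (iter k cstep (a, g)) => -[|s b] h //= bS.
by rewrite perm_rcons.
Qed.

Lemma arrow_cstep k a t1 t2 g : perm_eq a (enum S) -> arrow_at t1 t2 (a, g) ->
  arrow_at t1 t2 (iter k cstep (a, g)).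
Proof.
move=> aS ar; elim: k => //= k; have := cstep_perm k g aS.
case: (iter k cstep (a, g)) => -[|s b] h //= sbS.
by rewrite /arrow_at /= !conjgM; exact: o_rot.
Qed.

(** Rotate until [t1] is the first letter, where [o_first] gives the arrow. On the way [t2] is never
    first, as [om] is nonnegative from the first letter to positive roots; so each letter passed
    lies outside [P], and conjugation by it keeps cone generators. *)
Lemma exists_arrow a t1 : perm_eq a (enum S) -> t1 \in T ->
  forall (P : {group gT}) t2, irr_rank2_parabolic W S P ->
  cone_generators (T :&: P) t1 t2 -> 0 < om a (rt t1) (rt t2) ->
  exists k, arrow_at t1 t2 (iter k cstep (a, 1%g)).
Proof.
move: a t1; apply: rot_ind => [s a saS P t2 irrP cone _|s a t1 saS t1T t1s IH P t2 irrP cone om0].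
  by exists 0%N; rewrite /arrow_at /= !conjg1; exact: o_first cone.
have sS := first_simple saS; have sW := simple_mem sS.
have [_ + _ _] := cone; rewrite inE => /andP[t2T t2P].
have t2s : t2 != s.
  apply: contraTneq om0 => ->; rewrite omC om_first // -leNgt oppr_le0.
  exact: mm_ge0.
have sP : s \notin P.
  apply/negP=> sP; have sA : s \in T :&: P by rewrite inE simple_refl.
  have [E|E] := cone_generators_simple (subsetIl _ _) sS sA cone.
    by rewrite E eqxx in t1s.
  by rewrite E eqxx in t2s.
have irrP' : irr_rank2_parabolic W S (P :^ s)%G.
  case: irrP => -[J [g gW [JS J2 PE]]] nab; split; last by rewrite abelianJ.
  by exists J, (g * s)%g; rewrite ?groupM //; split=> //; rewrite conjsgM -PE.
have [||k kP] := IH (P :^ s)%G (t2 ^ s)%g irrP'.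
- exact: cone_generators_conj.
- by rewrite -!act_simple_rt // om_rot.
exists k.+1; move: kP; rewrite iterSr /cstep /= -/cstep mul1g (cstep_mul k (rcons a s) s).
by rewrite /arrow_at /= !conjgM.
Qed.

Lemma om_arrow a (P : {group gT}) t1 t2 : perm_eq a (enum S) ->
  irr_rank2_parabolic W S P -> cone_generators (T :&: P) t1 t2 ->
  0 < om a (rt t1) (rt t2) -> o (\prod_(r <- a) r)%g t1 t2.
Proof.
move=> aS irrP cone om0; have [+ _ _ _] := cone; rewrite inE => /andP[t1T _].
have [k kP] := exists_arrow aS t1T irrP cone om0.
have a0 : (0 < size a)%N by case: (a) om0; rewrite //= ltxx.
(* After the [k] rotations, go on up to a multiple of the period that is at least [k]: the arrow is
   then back at the initial word. *)
have lek : (k <= k * (size a * #[\prod_(r <- a) r]%g))%N.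
  by rewrite leq_pmulr // muln_gt0 a0 order_gt0.
have := cstep_period a k; rewrite -(subnK lek) iterD => E.
have := cstep_perm k 1%g aS; move: kP E; case: (iter k cstep _) => b g kP E bS.
have := arrow_cstep (k * (size a * #[\prod_(r <- a) r]%g) - k) bS kP.
by rewrite E /arrow_at /= !conjg1.
Qed.

(** If [om] were negative, [om_arrow] would give the opposite arrow as well. A directed cycle with
    arrows both ways between two elements has no third one, but [t1 ^ t2] is a third reflection of
    [P]. *)
Lemma arrow_om a (P : {group gT}) t1 t2 : perm_eq a (enum S) ->
  irr_rank2_parabolic W S P -> cone_generators (T :&: P) t1 t2 ->
  directed_cycle_on (o (\prod_(r <- a) r)%g) (T :&: P) ->
  ~ commute t1 t2 -> o (\prod_(r <- a) r)%g t1 t2 ->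
  0 < om a (rt t1) (rt t2).
Proof.
move=> aS irrP cone [l [ul lE oE]] ncom o12.
have [t1A t2A t12 _] := cone; have := t1A; have := t2A; rewrite !inE.
move=> /andP[t2T _] /andP[t1T _].
have [tA _ tE] := cone_reflect cone.
have ct : (t1 ^ t2)%g != t1.
  by apply/eqP=> E; apply: ncom; apply/commgP/conjg_fixP.
have d0 : dot (rt t1) (rt t2) != 0.
  apply: contra ct => /eqP d0; move: tE; rewrite d0 mulr0 scale0r subr0 => tE.
  by apply/eqP/(rd_rt_inj rd) => //; move: tA; rewrite inE => /andP[].
have := om_neq0 aS t1T t2T t12 d0.
case: ltgtP => // om0 _.
have o21 : o (\prod_(r <- a) r)%g t2 t1.
  by apply: om_arrow (cone_generatorsC cone) _ => //; rewrite omC oppr_gt0.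
move: o12 o21; rewrite !oE // => /eqP E1 /eqP E2.
have [|i l' rotE] := @rot_to _ l t1; first by rewrite lE.
rewrite -(next_rot i ul) rotE in E1; rewrite -(next_rot i ul) rotE in E2.
have ul' : uniq (t1 :: l') by rewrite -rotE rot_uniq.
have mem t : t \in T :&: P -> t \in t1 :: l' by rewrite -rotE mem_rot lE.
case: l' {rotE} E1 E2 ul' mem => [|y l'] /=; rewrite eqxx => E1.
  by rewrite E1 eqxx in t12.
subst y; rewrite eq_sym (negbTE t12) => E2 ul' mem.
case: l' E2 ul' mem => [|y l'] /=; rewrite eqxx => E2 ul' mem.
  have := mem _ tA; rewrite !inE (negbTE ct) /= => /eqP E.
  by move: t12; rewrite -(inj_eq (conjg_inj t2)) E conjg_simple_id eqxx.
by move: ul'; rewrite E2 !inE eqxx !orbT.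
Qed.

End OrientationFamily.

End RootDatum.

(** * Chambers and facets of reflection arrangements *)

Section DotProduct.

Import Order.TTheory GRing.Theory Num.Theory.
Import numFieldNormedType.Exports.
Local Open Scope ring_scope.
Local Open Scope classical_set_scope.

Variables (R : realType) (n : nat).
Implicit Types (u v e x y : 'rV[R]_n).

Definition dotv u v : R := (u *m v^T) 0 0.

Lemma dotvE u v : dotv u v = \sum_j u 0 j * v 0 j.
Proof. by rewrite /dotv mxE; apply: eq_bigr => j _; rewrite mxE. Qed.

Lemma dotvC u v : dotv u v = dotv v u.
Proof. by rewrite !dotvE; apply: eq_bigr => j _; rewrite mulrC. Qed.

Lemma dotvDl u v z : dotv (u + v) z = dotv u z + dotv v z.
Proof. by rewrite /dotv mulmxDl mxE. Qed.

Lemma dotvZl k u v : dotv (k *: u) v = k * dotv u v.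
Proof. by rewrite /dotv -scalemxAl mxE. Qed.

Lemma dotvDr u v z : dotv z (u + v) = dotv z u + dotv z v.
Proof. by rewrite dotvC dotvDl !(dotvC _ z). Qed.

Lemma dotvZr k u v : dotv v (k *: u) = k * dotv v u.
Proof. by rewrite dotvC dotvZl (dotvC u). Qed.

Lemma dotvNl u v : dotv (- u) v = - dotv u v.
Proof. by rewrite -scaleN1r dotvZl mulN1r. Qed.

Lemma dotvNr u v : dotv v (- u) = - dotv v u.
Proof. by rewrite dotvC dotvNl dotvC. Qed.

Lemma dotv0l v : dotv 0 v = 0.
Proof. by rewrite /dotv mul0mx mxE. Qed.

Lemma dotv0r v : dotv v 0 = 0.
Proof. by rewrite dotvC dotv0l. Qed.

Lemma dotv_suml (I : Type) (r : seq I) (P : pred I) (F : I -> 'rV[R]_n) v :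
  dotv (\sum_(i <- r | P i) F i) v = \sum_(i <- r | P i) dotv (F i) v.
Proof.
by apply: (big_morph (fun u => dotv u v)) => [a b|]; rewrite ?dotv0l // dotvDl.
Qed.

Lemma dotv_sumr (I : Type) (r : seq I) (P : pred I) (F : I -> 'rV[R]_n) v :
  dotv v (\sum_(i <- r | P i) F i) = \sum_(i <- r | P i) dotv v (F i).
Proof. by rewrite dotvC dotv_suml; apply: eq_bigr => i _; rewrite dotvC. Qed.

Definition dotvEE := (dotvDl, dotvDr, dotvNl, dotvNr, dotvZl, dotvZr, dotv0l, dotv0r).

Lemma dotv_ge0 v : 0 <= dotv v v.
Proof. by rewrite dotvE sumr_ge0 // => j _; rewrite -expr2 sqr_ge0. Qed.

Lemma dotv_eq0 v : dotv v v = 0 -> v = 0.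
Proof.
rewrite dotvE => /eqP; rewrite psumr_eq0 => [/allP v0|j _]; last by rewrite -expr2 sqr_ge0.
apply/rowP=> j; rewrite mxE; have := v0 j; rewrite mem_index_enum => /(_ isT) /=.
by rewrite mulf_eq0 orbb => /eqP.
Qed.

Lemma dotv_gt0 v : v != 0 -> 0 < dotv v v.
Proof. by move=> v0; rewrite lt0r dotv_ge0 andbT; apply: contra v0 => /eqP/dotv_eq0/eqP. Qed.

Lemma dotv_continuous e : continuous (dotv e).
Proof.
rewrite (_ : dotv e = fun u => \sum_j e 0 j * u 0 j); last by apply/funext=> u; rewrite dotvE.
elim: (index_enum _) => [|j r IHr] u.
  rewrite (_ : (fun _ => _) = fun=> 0); last by apply/funext=> v; rewrite big_nil.
  exact: cst_continuous.
rewrite (_ : (fun _ => _) = (fun v : 'rV[R]_n => e 0 j * v 0 j) \+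
    (fun v => \sum_(i <- r) e 0 i * v 0 i)); last by apply/funext=> v; rewrite big_cons.
have cj : continuous (fun v : 'rV[R]_n => e 0 j * v 0 j).
  move=> v; apply: (@continuous_comp _ _ _ (fun v : 'rV[R]_n => v 0 j) ( *%R (e 0 j))).
    exact: coord_continuous.
  exact: mulrl_continuous.
by apply: cvgD; [exact: nbhs_filter|exact: cj|exact: IHr].
Qed.

Definition open_cone (E : seq 'rV[R]_n) : set 'rV[R]_n :=
  [set v | forall e, e \in E -> 0 < dotv e v].

Lemma closure_open_cone_ge0 E e v : e \in E -> closure (open_cone E) v -> 0 <= dotv e v.
Proof.
move=> eE clv; rewrite leNgt; apply/negP=> ev.
have : nbhs v (dotv e @^-1` [set z | z < 0]).
  apply: dotv_continuous; exact: lt_nbhsl.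
by case/clv=> u [/(_ e eE) /= u0 /= u0']; have := lt_trans u0 u0'; rewrite ltxx.
Qed.

Lemma segment_continuous x y : continuous (fun k : R => x + k *: y).
Proof. by move=> k; apply: cvgD; [exact: cvg_cst|apply: cvgZr_tmp; exact: cvg_id]. Qed.

Lemma ge0_closure_open_cone E x v : open_cone E x ->
  (forall e, e \in E -> 0 <= dotv e v) -> closure (open_cone E) v.
Proof.
move=> Ex v0 B nB.
have := @segment_continuous v x 0; rewrite /continuous_at scale0r addr0 => /(_ B nB).
move=> /nbhs_ballP[r /= r0 rB].
exists (v + (r / 2) *: x); split.
  by move=> e eE; rewrite !dotvEE ltr_wpDl ?v0 // mulr_gt0 ?Ex // divr_gt0.
apply: rB; rewrite /ball /= sub0r normrN ger0_norm; last by rewrite divr_ge0 // ltW.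
by rewrite ltr_pdivrMr // ltr_pMr // ltr1n.
Qed.

Lemma open_cone_component (E : seq 'rV[R]_n) x : open_cone E x ->
  connected_component [set v | forall e, e \in E -> dotv e v <> 0] x = open_cone E.
Proof.
move=> Ex; apply/seteqP; split=> y.
  case=> B [Bx BE Bcon] By e eE; rewrite ltNge; apply/negP=> ey.
  have : connected (dotv e @` B).
    apply: connected_continuous_connected => //.
    by apply: continuous_subspaceT; exact: dotv_continuous.
  move/connected_intervalP => itv.
  have /itv : (dotv e @` B) (dotv e y) by exists y.
  move=> /(_ (dotv e x)) /(_ _ 0) [||u Bu u0]; first by exists x.
    by rewrite ey ltW // Ex.
  exact: BE Bu _ eE u0.
move=> Ey; pose f (k : R) := x + k *: (y - x).
have con : connected (f @` `[0, 1]).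
  apply: connected_continuous_connected; first exact: segment_connected.
  by apply: continuous_subspaceT; exact: segment_continuous.
exists (f @` `[0, 1]); last first.
  by exists 1; rewrite /= ?in_itv /= ?ler01 ?lexx // /f scale1r addrC subrK.
split=> //.
  by exists 0; rewrite /= ?in_itv /= ?ler01 ?lexx // /f scale0r addr0.
move=> _ [k /= + <-] e eE; rewrite in_itv /= => /andP[k0 k1].
rewrite /f !dotvEE; have := Ex e eE; have := Ey e eE => ey ex.
have -> : dotv e x + k * (dotv e y - dotv e x) = (1 - k) * dotv e x + k * dotv e y by ring.
have A : 0 <= (1 - k) * dotv e x by rewrite mulr_ge0 ?subr_ge0 // ltW.
have B : 0 <= k * dotv e y by rewrite mulr_ge0 // ltW.
move=> E0; have /eqP : k * dotv e y = 0 by lra.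
by rewrite mulf_eq0 (gt_eqF ey) orbF => /eqP kz; move: E0; rewrite kz; lra.
Qed.

End DotProduct.

(** The part of a root datum available before the simple roots are known: unit normals, oriented by
    a base point. *)
Record normals (R : realType) (gT : finGroupType) (W : {group gT}) (S : {set gT})
    (n : nat) (rG : mx_representation R W n) (x0 : 'rV[R]_n)
    (rt : gT -> 'rV[R]_n) : Prop := Normals {
  nm_unit : forall t, t \in reflections W S -> dotv (rt t) (rt t) = 1%R;
  nm_pos : forall t, t \in reflections W S -> (0 < dotv (rt t) x0)%R;
  nm_refl : forall t v, t \in reflections W S ->
    (v *m rG t = v - (2 * dotv v (rt t)) *: rt t)%R;
  nm_orth : forall g u v, g \in W -> dotv (u *m rG g) (v *m rG g) = dotv u v
}.

(** * Unit normals of the reflections *)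

Section Normals.

Import Order.TTheory GRing.Theory Num.Theory.
Import numFieldNormedType.Exports.
Local Open Scope ring_scope.
Local Open Scope classical_set_scope.

Variables (R : realType) (gT : finGroupType) (W : {group gT}) (S : {set gT}).
Variables (n : nat) (rG : mx_representation R W n).

Local Notation T := (reflections W S).

Lemma reflection_preserves (M : 'M[R]_n) u v : orthogonal_reflection M ->
  dotv (u *m M) (v *m M) = dotv u v.
Proof.
case=> e e0 ME; rewrite !ME -!/(dotv _ _) !dotvEE.
have d0 : dotv e e != 0 by rewrite gt_eqF // dotv_gt0.
by rewrite (dotvC e v); field.
Qed.

Lemma orthogonal_repr g u v : <<S>>%g = W ->
  (forall s, s \in S -> orthogonal_reflection (rG s)) -> g \in W ->
  dotv (u *m rG g) (v *m rG g) = dotv u v.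
Proof.
move=> genS reflS; rewrite -{1}genS => /word_for_exists[b /andP[/allP bS /eqP <-]].
have mem s : s \in S -> s \in W by rewrite -genS; exact: mem_gen.
elim: b bS u v => [|s b IHb] bS u v; first by rewrite big_nil repr_mx1 !mulmx1.
have sS : s \in S by apply: bS; rewrite mem_head.
have bS' x : x \in b -> x \in S by move=> xb; apply: bS; rewrite inE xb orbT.
rewrite big_cons repr_mxM ?(mem s sS) //; last first.
  by rewrite big_seq group_prod // => x /bS' /mem.
by rewrite !mulmxA IHb // reflection_preserves //; exact: reflS.
Qed.

Lemma reflection_conj t : <<S>>%g = W ->
  (forall s, s \in S -> orthogonal_reflection (rG s)) -> t \in T ->
  orthogonal_reflection (rG t).
Proof.
move=> genS reflS /imset2P[s g sS gW ->].
have sW : s \in W by rewrite -genS mem_gen.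
have [e e0 eE] := reflS s sS.
exists (e *m rG g).
  apply: contra e0 => /eqP e0; rewrite -[e]mulmx1 -(repr_mx1 rG) -(mulgV g).
  by rewrite repr_mxM ?groupV // mulmxA e0 mul0mx.
move=> v; rewrite conjgE !repr_mxM ?groupM ?groupV // !mulmxA.
set u := v *m rG g^-1%g.
have uE : u *m rG g = v by rewrite -mulmxA -repr_mxM ?groupV // mulVg repr_mx1 mulmx1.
rewrite eE mulmxBl uE -scalemxAl -!/(dotv _ _) (orthogonal_repr e e) //.
by rewrite -[in RHS]uE orthogonal_repr // uE.
Qed.

Lemma exists_normals x0 : <<S>>%g = W ->
  (forall s, s \in S -> orthogonal_reflection (rG s)) ->
  arrangement_compl rG T x0 -> exists rt, normals S rG x0 rt.
Proof.
move=> genS reflS x0T.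
have /choice[rt rtP] : forall t, exists e : 'rV[R]_n, t \in T ->
    [/\ dotv e e = 1, 0 < dotv e x0 &
        forall v, v *m rG t = v - (2 * dotv v e) *: e].
  move=> t; have [tT|] := boolP (t \in T); last by exists 0.
  have [e e0 eE] := reflection_conj genS reflS tT.
  have d0 := dotv_gt0 e0; pose k := Num.sqrt (dotv e e).
  have k0 : 0 < k by rewrite sqrtr_gt0.
  have kk : k * k = dotv e e by rewrite -expr2 sqr_sqrtr // ltW.
  have kn : k != 0 by rewrite gt_eqF.
  pose f := k^-1 *: e.
  have ff : dotv f f = 1 by rewrite !dotvEE -kk; field.
  have fE v : v *m rG t = v - (2 * dotv v f) *: f.
    rewrite eE -!/(dotv _ _) -kk !dotvEE scalerA; congr (_ - _ *: _); field.
    exact: kn.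
  (* The base point lies on no mirror, so one of the two unit normals is positive on it. *)
  have fx : dotv f x0 != 0.
    apply/eqP=> fx; apply: (x0T t tT); rewrite /mirror /= fE dotvC fx.
    by rewrite mulr0 scale0r subr0.
  have [fpos|fneg] := ltP 0 (dotv f x0); first by exists f.
  exists (- f) => _; split; first by rewrite dotvNl dotvNr opprK.
    by rewrite dotvNl oppr_gt0 lt_neqAle fx.
  by move=> v; rewrite fE dotvNr mulrN scalerN scaleNr opprK.
exists rt; split=> [t /rtP[]|t /rtP[]|t v /rtP[]|] //.
by move=> g u v; exact: orthogonal_repr.
Qed.

Variables (x0 : 'rV[R]_n) (rt : gT -> 'rV[R]_n).
Hypothesis nm : normals S rG x0 rt.

Lemma nm_prop t s k : t \in T -> s \in T -> rt t = k *: rt s -> rt t = rt s.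
Proof.
move=> tT sT tE; have tp := nm_pos nm tT; have sp := nm_pos nm sT.
have := nm_unit nm tT; rewrite tE !dotvEE (nm_unit nm) // mulr1 => kk.
suff -> : k = 1 by rewrite scale1r.
have k0 : 0 < k by move: tp; rewrite tE dotvZl pmulr_lgt0.
nra.
Qed.

Lemma nm_inj : mx_faithful rG -> T \subset W -> {in T &, injective rt}.
Proof.
move=> ff /fintype.subsetP TW t s tT sT ts.
apply: (mx_faithful_inj ff); rewrite ?TW //; apply/row_matrixP=> i.
by rewrite !rowE !(nm_refl nm) // ts.
Qed.

Lemma mirrorP t v : t \in T -> mirror rG t v <-> dotv (rt t) v = 0.
Proof.
move=> tT; rewrite /mirror /= (nm_refl nm) // (dotvC v); split=> [/eqP|->].
  rewrite -subr_eq0 addrAC subrr add0r oppr_eq0 scaler_eq0 => /orP[|/eqP r0].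
    by rewrite mulf_eq0 pnatr_eq0 /= => /eqP.
  by rewrite r0 dotv0l.
by rewrite mulr0 scale0r subr0.
Qed.

(** * The chamber of a subarrangement and its simple system *)

Section SubArrangement.

Variable A : {set gT}.
Hypothesis AT : A \subset T.

Definition chamber : set 'rV[R]_n := [set v | forall t, t \in A -> 0 < dotv (rt t) v].

Let memT t : t \in A -> t \in T := fintype.subsetP AT t.

Lemma chamberE : chamber = open_cone [seq rt t | t <- enum A].
Proof.
apply/seteqP; split=> v Av => [_ /mapP[t + ->]|t tA].
  by rewrite mem_enum; exact: Av.
by apply: Av; apply/mapP; exists t; rewrite ?mem_enum.
Qed.

Lemma arrangement_complE : arrangement_compl rG A =
  [set v | forall e, e \in [seq rt t | t <- enum A] -> dotv e v <> 0].
Proof.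
apply/seteqP; split=> v Av => [_ /mapP[t + ->]|t tA].
  by rewrite mem_enum => tA /(mirrorP _ (memT tA)); exact: Av.
by move/(mirrorP _ (memT tA)); apply: Av; apply/mapP; exists t; rewrite ?mem_enum.
Qed.

Lemma chamber_x0 : chamber x0.
Proof. by move=> t /memT; exact: nm_pos nm _. Qed.

Lemma chamber_compl : arrangement_compl rG A x0.
Proof.
rewrite arrangement_complE => _ /mapP[t + ->]; rewrite mem_enum => /memT tT.
by have := nm_pos nm tT; move=> + E; rewrite E ltxx.
Qed.

Lemma component_x0 : connected_component (arrangement_compl rG A) x0 = chamber.
Proof.
by rewrite arrangement_complE chamberE open_cone_component // -chamberE; exact: chamber_x0.
Qed.

Lemma region_chamber : region rG A chamber.
Proof. by exists x0; [exact: chamber_compl|rewrite component_x0]. Qed.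

Lemma region_x0 D : region rG A D -> D x0 -> D = chamber.
Proof.
case=> x Ax -> Dx0; rewrite -component_x0; apply/seteqP; split=> y.
  by move=> xy; apply: connected_component_trans xy; exact: connected_component_sym.
by apply: connected_component_trans.
Qed.

Hypothesis Aconj : forall t t', t \in A -> t' \in A -> (t ^ t')%g \in A.
Hypothesis rt_conj : forall t t', t \in A -> t' \in A ->
  rt t *m rG t' = rt (t ^ t')%g \/ rt t *m rG t' = - rt (t ^ t')%g.
Hypothesis rt_inj : {in A &, injective rt}.

Definition spanning (D : {set gT}) : Prop := D \subset A /\
  forall t, t \in A -> exists2 l : gT -> R, forall d, 0 <= l d &
    rt t = \sum_(d in D) l d *: rt d.

Lemma spanning_all : spanning A.
Proof.
split=> // t tA; exists (fun d => (d == t)%:R); first by move=> d; exact: ler0n.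
rewrite (bigD1 t) //= eqxx scale1r big1 ?addr0 // => d /andP[_ /negbTE ->].
by rewrite scale0r.
Qed.

Section MinimalSpanning.

Variable D : {set gT}.
Hypothesis Dspan : spanning D.
Hypothesis Dmin : forall D' : {set gT}, D' \subset D -> spanning D' -> D' = D.

Let memD d : d \in D -> d \in A := fintype.subsetP Dspan.1 d.

(** If [m d] is less than [k], solving for [rt d] makes [d] redundant, against minimality. Otherwise
    moving [m d *: rt d] to the left makes that side nonpositive on [x0], while the term of [d']
    keeps the other side positive. *)
Lemma irredundant d d' (k : R) (m : gT -> R) : d \in D -> d' \in D -> d' != d ->
  (forall e, 0 <= m e) -> 0 < m d' ->
  k *: rt d = \sum_(e in D) m e *: rt e -> False.
Proof.
move=> dD d'D dd' m0 md' kE.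
have pos e : e \in D -> 0 < dotv (rt e) x0 by move/memD/memT; exact: nm_pos nm _.
have sumE : k *: rt d = m d *: rt d + \sum_(e in D :\ d) m e *: rt e.
  by rewrite kE (bigD1 d) //=; congr (_ + _); apply: eq_bigl => e; rewrite !inE andbC.
have [lt_k|le_k] := ltP (m d) k; last first.
  have := congr1 (fun v => dotv v x0) sumE; rewrite dotvDl !dotvZl dotv_suml.
  have d'D' : d' \in D :\ d by rewrite !inE dd'.
  rewrite (bigD1 d') //= => E.
  have : 0 <= \sum_(i in D :\ d | i != d') dotv (m i *: rt i) x0.
    apply: sumr_ge0 => i /andP[]; rewrite !inE => /andP[_ iD] _.
    by rewrite dotvZl mulr_ge0 ?m0 // ltW // pos.
  have := mulr_gt0 md' (pos _ d'D); rewrite -dotvZl.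
  have := pos _ dD; nra.
have k0 : k - m d != 0 by rewrite subr_eq0 gt_eqF.
pose c := (k - m d)^-1; have c0 : 0 < c by rewrite invr_gt0 subr_gt0.
have dE : rt d = \sum_(e in D :\ d) (c * m e) *: rt e.
  under eq_bigr => e _ do rewrite -scalerA.
  rewrite -scaler_sumr; apply: (scalerI k0); rewrite scalerA mulfV // scale1r.
  by rewrite scalerBl sumE addrC addKr.
have : spanning (D :\ d).
  split=> [|t tA]; first exact: fintype.subset_trans (subD1set _ _) Dspan.1.
  have [l l0 tE] := Dspan.2 t tA.
  exists (fun e => l d * (c * m e) + l e).
    by move=> e; rewrite addr_ge0 // mulr_ge0 // mulr_ge0 // ltW.
  rewrite tE (bigD1 d) //= {1}dE scaler_sumr.
  have -> : \sum_(i in D | i != d) l i *: rt i = \sum_(i in D :\ d) l i *: rt i.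
    by apply: eq_bigl => e; rewrite !inE andbC.
  by rewrite -big_split; apply: eq_bigr => e _; rewrite /= scalerDl scalerA.
move/(Dmin (subD1set _ _)) => DE.
by have := setD11 d D; rewrite DE dD.
Qed.

(** For a positive product [b], expand the root of [d' ^ d], which is [rt d' - 2 b rt d] up to sign:
    one sign writes [rt d'], the other [2 b rt d], as a combination excluded by [irredundant]. *)
Lemma minimal_obtuse d d' : d \in D -> d' \in D -> d' != d -> dotv (rt d) (rt d') <= 0.
Proof.
move=> dD d'D dd'; rewrite leNgt; apply/negP=> pos.
have tA : (d' ^ d)%g \in A by apply: Aconj; exact: memD.
have [l l0 tE] := Dspan.2 _ tA.
have := rt_conj (memD d'D) (memD dD).
rewrite (nm_refl nm) ?memT ?memD // tE (dotvC (rt d')); set b := dotv _ _ in pos *.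
have addE (e : gT) (z : R) : e \in D ->
    \sum_(i in D) (l i + (i == e)%:R * z) *: rt i =
    \sum_(i in D) l i *: rt i + z *: rt e.
  move=> eD; under eq_bigr => i _ do rewrite scalerDl.
  rewrite big_split /=; congr (_ + _).
  rewrite (bigD1 e) //= eqxx mul1r big1 ?addr0 // => i /andP[_ /negbTE ->].
  by rewrite mul0r scale0r.
case=> E.
  apply: (@irredundant d' d 1 (fun i => l i + (i == d)%:R * (2 * b))) => //.
  - by rewrite eq_sym.
  - by move=> e; rewrite addr_ge0 // mulr_ge0 ?ler0n // mulr_ge0 // ltW.
  - by rewrite ltr_wpDl // eqxx mul1r mulr_gt0.
  - by rewrite addE // -E subrK scale1r.
apply: (@irredundant d d' (2 * b) (fun i => l i + (i == d')%:R * 1)) => //.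
- by move=> e; rewrite addr_ge0 // mulr_ge0 ?ler0n.
- by rewrite ltr_wpDl // eqxx mul1r.
- by rewrite addE // -[\sum_(i in D) _]opprK -E scale1r opprB subrK.
Qed.

(** Separate the terms with positive coefficients from the others. As the roots are pairwise obtuse,
    the square of the positive part is at most zero, so this part vanishes; but each of its terms is
    positive on [x0]. *)
Lemma minimal_free (k : gT -> R) : \sum_(d in D) k d *: rt d = 0 ->
  forall d, d \in D -> k d = 0.
Proof.
have aux (c : gT -> R) : \sum_(d in D) c d *: rt d = 0 -> forall d, d \in D -> c d <= 0.
  move=> sum0; pose v := \sum_(d in D | 0 < c d) c d *: rt d.
  pose u := \sum_(d in D | ~~ (0 < c d)) c d *: rt d.
  have uv : v = - u.
    by apply/eqP; rewrite -addr_eq0 /v /u -(bigID (fun d => 0 < c d)) sum0.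
  have v0 : v = 0.
    apply: dotv_eq0; apply/eqP; rewrite eq_le dotv_ge0 andbT {2}uv dotvNr oppr_le0.
    rewrite dotv_suml sumr_ge0 // => d /andP[dD cd].
    rewrite dotv_sumr sumr_ge0 // => d' /andP[d'D cd'].
    rewrite dotvZl dotvZr mulr_ge0 ?(ltW cd) // mulr_le0 //.
      by rewrite leNgt.
    by apply: minimal_obtuse => //; apply: contraNneq cd' => ->.
  move=> d dD; rewrite leNgt; apply/negP=> cd.
  have : 0 < dotv v x0.
    rewrite dotv_suml (bigD1 d) ?dD //= ltr_pwDl //.
      by rewrite dotvZl mulr_gt0 ?(nm_pos nm) ?memT ?memD.
    apply: sumr_ge0 => d' /andP[/andP[d'D cd'] _].
    by rewrite dotvZl mulr_ge0 ?(ltW cd') // ltW ?(nm_pos nm) ?memT ?memD.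
  by rewrite v0 dotv0l ltxx.
move=> sum0 d dD; apply/eqP; rewrite eq_le aux //= -oppr_le0.
apply: (aux (fun d => - k d)) => //; under eq_bigr => e _ do rewrite scaleNr.
by rewrite sumrN sum0 oppr0.
Qed.

Lemma minimal_dual : exists wt : gT -> 'rV[R]_n,
  forall d d', d \in D -> d' \in D -> dotv (rt d) (wt d') = (d == d')%:R.
Proof.
pose M := \matrix_(i < #|D|) rt (enum_val i).
have : row_free M.
  apply: inj_row_free => v; rewrite mulmx_sum_row => vM.
  apply/rowP=> i; rewrite mxE.
  pose k d := \sum_(j < #|D|) (enum_val j == d)%:R * v 0 j.
  have kE (j : 'I_#|D|) : k (enum_val j) = v 0 j.
    rewrite /k (bigD1 j) //= eqxx mul1r big1 ?addr0 // => l /negbTE lj.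
    by rewrite (inj_eq enum_val_inj) lj mul0r.
  rewrite -kE; apply: (@minimal_free k); last exact: enum_valP.
  rewrite big_enum_val -[RHS]vM; apply: eq_bigr => j _.
  by rewrite kE rowK.
case/row_freeP=> B MB.
have /choice[wt wtP] : forall d', exists w : 'rV[R]_n, d' \in D ->
    forall d, d \in D -> dotv (rt d) w = (d == d')%:R.
  move=> d'; have [d'D|] := boolP (d' \in D); last by exists 0.
  exists (col (enum_rank_in d'D d') B)^T => _ d dD.
  have := congr1 (fun N : 'M_#|D| => N (enum_rank_in d'D d) (enum_rank_in d'D d')) MB.
  have -> : (d == d') = (enum_rank_in d'D d == enum_rank_in d'D d').
    by apply/eqP/eqP=> [->//|/(congr1 enum_val)]; rewrite !enum_rankK_in.
  rewrite !mxE => <-; rewrite dotvE; apply: eq_bigr => j _.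
  by rewrite !mxE enum_rankK_in.
by exists wt => d d' dD d'D; exact: wtP.
Qed.

End MinimalSpanning.

Definition simple_system (D : {set gT}) (wt : gT -> 'rV[R]_n) : Prop :=
  [/\ D \subset A,
      forall d d', d \in D -> d' \in D -> dotv (rt d) (wt d') = (d == d')%:R,
      forall t, t \in A -> rt t = \sum_(d in D) dotv (rt t) (wt d) *: rt d &
      forall t d, t \in A -> d \in D -> 0 <= dotv (rt t) (wt d)].

Lemma exists_simple_system : exists D wt, simple_system D wt.
Proof.
have [|D /minsetP[/asboolP Dspan Dmin]] := @ex_minset _ (fun D : {set gT} => `[< spanning D >]).
  by exists A; apply/asboolP; exact: spanning_all.
have {}Dmin (D' : {set gT}) : D' \subset D -> spanning D' -> D' = D.
  by move=> DD' D's; apply: Dmin => //; apply/asboolP.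
have [wt wtP] := minimal_dual Dspan Dmin.
have lE (l : gT -> R) d : d \in D -> dotv (\sum_(e in D) l e *: rt e) (wt d) = l d.
  move=> dD; rewrite dotv_suml (bigD1 d) //= dotvZl wtP // eqxx mulr1.
  rewrite big1 ?addr0 // => e /andP[eD /negbTE ed].
  by rewrite dotvZl wtP // ed mulr0.
exists D, wt; split=> //; first exact: Dspan.1.
  move=> t tA; have [l l0 tE] := Dspan.2 t tA; rewrite {1}tE.
  by apply: eq_bigr => d dD; rewrite tE lE.
by move=> t d tA dD; have [l l0 ->] := Dspan.2 t tA; rewrite lE.
Qed.

(** If [t] defines a facet, any [d] with a positive coefficient in [rt t] vanishes on that face,
    hence on the mirror, so [d = t]. Conversely, the projections [p i] of the standard basis to the
    mirror are pushed into the closed chamber by a large multiple of [z], a relative interior point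
    of the face. *)
Lemma simple_system_facet D wt t : simple_system D wt -> t \in A ->
  defines_facet rG chamber t <-> t \in D.
Proof.
case=> DA wtP expand ge0 tA; have tT := memT tA.
have memD d : d \in D -> d \in A by exact: (fintype.subsetP DA).
split=> [[B Brow Bspan]|tD].
  have [d dD td] : exists2 d, d \in D & 0 < dotv (rt t) (wt d).
    have [//|no] := pselect (exists2 d, d \in D & 0 < dotv (rt t) (wt d)).
    have := nm_unit nm tT; rewrite {1}(expand _ tA) big1 ?dotv0l => [|d dD].
      by move/eqP; rewrite eq_sym oner_eq0.
    suff -> : dotv (rt t) (wt d) = 0 by rewrite scale0r.
    apply/eqP; rewrite eq_le ge0 // andbT leNgt; apply/negP=> td.
    by apply: no; exists d.
  have rowd i : dotv (rt d) (row i B) = 0.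
    have [cl /(mirrorP _ tT) tB] := Brow i.
    have pos e : e \in A -> 0 <= dotv (rt e) (row i B).
      move=> eA; rewrite chamberE in cl; apply: closure_open_cone_ge0 cl.
      by apply/mapP; exists e; rewrite ?mem_enum.
    move/eqP: tB; rewrite (expand _ tA) dotv_suml psumr_eq0; last first.
      by move=> e eD; rewrite dotvZl mulr_ge0 ?ge0 // pos // memD.
    move/allP/(_ d); rewrite mem_index_enum dD => /(_ isT) /=.
    by rewrite dotvZl mulf_eq0 (gt_eqF td) => /eqP.
  have orth v : dotv (rt t) v = 0 -> dotv (rt d) v = 0.
    move=> /(mirrorP _ tT)/Bspan/submxP[m ->].
    rewrite mulmx_sum_row dotv_sumr big1 // => i _.
    by rewrite dotvZr rowd mulr0.
  have dT := memT (memD _ dD).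
  pose v := rt d - dotv (rt d) (rt t) *: rt t.
  have tv : dotv (rt t) v = 0.
    by rewrite /v !dotvEE (nm_unit nm) // (dotvC (rt t)); ring.
  have v0 : v = 0.
    by apply: dotv_eq0; rewrite {1}/v dotvDl dotvNl dotvZl orth // tv; ring.
  move/eqP: v0; rewrite subr_eq0 => /eqP /(nm_prop dT tT) E.
  by rewrite -(rt_inj (memD _ dD) tA E).
pose z := \sum_(d in D :\ t) wt d.
have zd d : d \in D -> dotv (rt d) z = (d != t)%:R.
  move=> dD; rewrite dotv_sumr; have [->|dt] := eqVneq d t.
    rewrite big1 // => e; rewrite !inE => /andP[/negbTE et eD].
    by rewrite wtP // eq_sym et.
  rewrite (bigD1 d) /=; last by rewrite !inE dt.
  rewrite wtP // eqxx big1 ?addr0 // => e; rewrite !inE => /andP[/andP[_ eD] /negbTE ed].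
  by rewrite wtP // eq_sym ed.
pose p (i : 'I_n) : 'rV[R]_n := delta_mx 0 i - dotv (rt t) (delta_mx 0 i) *: rt t.
have tp i : dotv (rt t) (p i) = 0.
  by rewrite /p !dotvEE (nm_unit nm) // mulr1 subrr.
pose M0 : R := \sum_i \sum_(d in D) `|dotv (rt d) (p i)|.
have M0P i d : d \in D -> - dotv (rt d) (p i) <= M0.
  move=> dD; apply: le_trans (ler_norm _) _; rewrite normrN.
  rewrite /M0 (bigD1 i) //= (bigD1 d) //= -addrA lerDl addr_ge0 //.
    by apply: sumr_ge0 => e _; exact: normr_ge0.
  by apply: sumr_ge0 => j _; apply: sumr_ge0 => e _; exact: normr_ge0.
pose sg : R := \sum_i z 0 i.
(* Weighting the rows of [B] by the coordinates of [z] yields [z] scaled by [1 + M * sg]; a nonzero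
   factor puts [z] in their span. *)
have [M MM0 Msg] : exists2 M, M0 <= M & 1 + M * sg != 0.
  have [E|E] := eqVneq (1 + M0 * sg) 0; last by exists M0.
  exists (M0 + 1); first by rewrite lerDl.
  apply/eqP=> E2; have sg0 : sg = 0 by lra.
  by move: E; rewrite sg0; lra.
pose B := \matrix_(i < n) (p i + M *: z).
have projE v : dotv (rt t) v = 0 -> v = \sum_i v 0 i *: p i.
  move=> tv; rewrite /p; under eq_bigr => i _ do rewrite scalerBr.
  rewrite sumrB -row_sum_delta.
  suff -> : \sum_i v 0 i *: (dotv (rt t) (delta_mx 0 i) *: rt t) = 0 by rewrite subr0.
  under eq_bigr => i _ do rewrite scalerA.
  rewrite -scaler_suml; suff -> : \sum_i v 0 i * dotv (rt t) (delta_mx 0 i) = dotv (rt t) v.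
    by rewrite tv scale0r.
  rewrite {2}(row_sum_delta v) dotv_sumr; apply: eq_bigr => i _.
  by rewrite dotvZr.
have tz : dotv (rt t) z = 0 by rewrite zd // eqxx.
exists B => [i|v /(mirrorP _ tT) tv].
  rewrite rowK; split; last by apply/mirrorP; rewrite // dotvDr dotvZr tp tz; ring.
  rewrite chamberE; apply: (@ge0_closure_open_cone _ _ _ x0).
    by rewrite -chamberE; exact: chamber_x0.
  move=> _ /mapP[e + ->]; rewrite mem_enum => eA.
  rewrite (expand _ eA) dotv_suml sumr_ge0 // => d dD.
  rewrite dotvZl mulr_ge0 ?ge0 // dotvDr dotvZr zd //.
  have [->|dt] := eqVneq d t; first by rewrite tp mulr0 addr0.
  by have := M0P i d dD; rewrite mulr1; lra.
have zB : (z <= B)%MS.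
  have -> : z = (1 + M * sg)^-1 *: \sum_i z 0 i *: row i B.
    under eq_bigr => i _ do rewrite rowK scalerDr scalerA.
    rewrite big_split /= -projE // -scaler_suml -mulr_suml -/sg.
    by rewrite -{2}(scale1r z) -scalerDl scalerA mulrC (mulrC sg) mulfV ?scale1r.
  by rewrite scalemx_sub // summx_sub // => i _; rewrite scalemx_sub // row_sub.
rewrite (projE v tv) summx_sub // => i _; rewrite scalemx_sub //.
have -> : p i = row i B - M *: z by rewrite rowK addrK.
by rewrite addmx_sub ?row_sub // eqmx_opp scalemx_sub.
Qed.

End SubArrangement.

End Normals.

(** * Uniqueness of simple systems in rank two *)

Section SimpleSystems.

Import Order.TTheory GRing.Theory Num.Theory.
Local Open Scope ring_scope.

Variables (R : realType) (gT : finGroupType) (W : {group gT}) (S : {set gT}).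
Variables (n : nat) (rG : mx_representation R W n).
Variables (x0 : 'rV[R]_n) (rt : gT -> 'rV[R]_n).
Hypothesis nm : normals S rG x0 rt.

Local Notation T := (reflections W S).

Hypothesis rt_inj : {in T &, injective rt}.
Variables (A D : {set gT}) (wt : gT -> 'rV[R]_n).
Hypothesis AT : A \subset T.
Hypothesis sys : simple_system rt A D wt.

Let memT t : t \in A -> t \in T := fintype.subsetP AT t.

Lemma simple_system_sub t : t \in D -> t \in A.
Proof. by case: sys => /fintype.subsetP DA _ _ _; exact: DA. Qed.

Lemma nm_eq t s k : t \in A -> s \in A -> rt t = k *: rt s -> t = s.
Proof.
move=> /memT tT /memT sT /(nm_prop nm tT sT); exact: rt_inj.
Qed.

Lemma nm_neq0 t : t \in A -> rt t <> 0.
Proof.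
move=> /memT tT t0; have := nm_unit nm tT; rewrite t0 dotv0l => /eqP.
by rewrite eq_sym oner_eq0.
Qed.

Lemma simple_system_pair t1 t2 : t1 != t2 -> D = [set t1; t2] ->
  cone_generators rt A t1 t2.
Proof.
have [_ _ expand ge0] := sys.
move=> t12 DE; have t1D : t1 \in D by rewrite DE !inE eqxx.
have t2D : t2 \in D by rewrite DE !inE eqxx orbT.
split; rewrite ?simple_system_sub // => t tA.
exists (dotv (rt t) (wt t1)), (dotv (rt t) (wt t2)); split; rewrite ?ge0 //.
by rewrite {1}expand // DE big_setU1 ?big_set1 // inE.
Qed.

Lemma simple_system_supp t d : t \in A -> d \in D ->
  (forall e, e \in D -> e != d -> dotv (rt t) (wt e) = 0) -> t = d.
Proof.
have [_ _ expand _] := sys.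
move=> tA dD t0; apply: (@nm_eq _ _ (dotv (rt t) (wt d))) => //.
  exact: simple_system_sub.
rewrite {1}expand // (bigD1 d) //= big1 ?addr0 // => e /andP[eD ed].
by rewrite t0 // scale0r.
Qed.

(** Each [d] of the simple system is [t1] or [t2], as a root entering its expansion has no
    coordinate besides that at [d]. Both occur, since one alone does not span the other. *)
Lemma cone_generators_system t1 t2 : cone_generators rt A t1 t2 -> D = [set t1; t2].
Proof.
have [_ wtP expand ge0] := sys.
case=> t1A t2A t12 cone.
have DE d : d \in D -> d = t1 \/ d = t2.
  move=> dD; have dA := simple_system_sub dD.
  have [x [y [x_ge0 y_ge0 dE]]] := cone d dA.
  have coords e : e \in D -> e != d ->
      x * dotv (rt t1) (wt e) = 0 /\ y * dotv (rt t2) (wt e) = 0.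
    move=> eD ed; have := wtP d e dD eD; rewrite dE eq_sym (negbTE ed) mulr0n !dotvEE.
    have := mulr_ge0 x_ge0 (ge0 _ _ t1A eD); have := mulr_ge0 y_ge0 (ge0 _ _ t2A eD).
    by move=> *; split; lra.
  have [xz|xn] := eqVneq x 0.
    right; apply: (@nm_eq _ _ y) => //; by rewrite dE xz scale0r add0r.
  left; symmetry; apply: simple_system_supp => // e eD ed.
  have [/eqP + _] := coords e eD ed; by rewrite mulf_eq0 (negbTE xn) => /eqP.
have inD t t' : t \in A -> t' \in A -> t != t' ->
    (forall d, d \in D -> d = t \/ d = t') -> t \in D.
  move=> tA t'A tt' tD; apply/negPn/negP=> tnD.
  have [t'D|t'D] := boolP (t' \in D); last first.
    apply: (nm_neq0 tA); rewrite (expand t tA) big1 // => d dD.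
    by case: (tD d dD) => E; rewrite E in dD; rewrite dD in tnD t'D.
  case/eqP: tt'; apply: simple_system_supp => // e eD.
  case: (tD e eD) => E et'; first by rewrite -E eD in tnD.
  by rewrite E eqxx in et'.
apply/setP=> d; rewrite !inE; apply/idP/orP=> [/DE[->|->]|[/eqP->|/eqP->]].
- by left.
- by right.
- exact: inD DE.
- by apply: (inD t2 t1); rewrite // 1?eq_sym // => d' /DE[->|->]; [right|left].
Qed.

Lemma plane_simple_system t1 t2 : t1 \in A -> t2 \in A -> t1 != t2 ->
  (forall t, t \in A -> in_plane rt t1 t2 t) ->
  exists d1 d2, cone_generators rt A d1 d2.
Proof.
have [_ wtP expand _] := sys.
move=> t1A t2A t12 plane.
suff: #|D| == 2.
  by case/cards2P=> d1 [d2 [d12 DE]]; exists d1, d2; exact: simple_system_pair.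
rewrite eqn_leq; apply/andP; split; rewrite leqNgt; apply/negP.
  case/card_gt2P=> r1 [r2 [r3 [[r1D r2D r3D] [r12 r23 r31]]]].
  have [x1 [y1 E1]] := plane _ (simple_system_sub r1D).
  have [x2 [y2 E2]] := plane _ (simple_system_sub r2D).
  have [x3 [y3 E3]] := plane _ (simple_system_sub r3D).
  pose A1 z := dotv (rt t1) z; pose A2 z := dotv (rt t2) z.
  have D1 z : dotv (rt r1) z = x1 * A1 z + y1 * A2 z by rewrite E1 !dotvEE.
  have D2 z : dotv (rt r2) z = x2 * A1 z + y2 * A2 z by rewrite E2 !dotvEE.
  have D3 z : dotv (rt r3) z = x3 * A1 z + y3 * A2 z by rewrite E3 !dotvEE.
  have := D1 (wt r1); have := D2 (wt r1).
  have := D1 (wt r2); have := D2 (wt r2).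
  have := D1 (wt r3); have := D2 (wt r3); have := D3 (wt r3).
  rewrite !wtP // !eqxx (negbTE r12) (negbTE r23) (eq_sym r2 r1) (eq_sym r1 r3).
  rewrite (negbTE r12) (negbTE r31) !mulr1n !mulr0n => F33 F23 F13 F22 F12 F21 F11.
  exact: (rank2_identity F11 F12 F13 F21 F22 F23 F33).
rewrite ltnS leq_eqVlt ltnS leqn0 => /orP[/cards1P[r DE]|/eqP/cards0_eq DE].
  have rD : r \in D by rewrite DE inE.
  have eqr t : t \in A -> t = r.
    by move=> tA; apply: simple_system_supp => // e; rewrite DE inE => ->.
  by rewrite (eqr t1) // (eqr t2) // eqxx in t12.
by apply: (nm_neq0 t1A); rewrite expand // DE big_set0.
Qed.

End SimpleSystems.

(** * The root datum of a reflection realization *)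

Section Realization.

Import Order.TTheory GRing.Theory Num.Theory.
Local Open Scope ring_scope.

Variables (R : realType) (gT : finGroupType) (W : {group gT}) (S : {set gT}).
Variables (n : nat) (rG : mx_representation R W n) (C : set 'rV[R]_n).
Hypothesis hWS : coxeter_system W S.

Local Notation T := (reflections W S).

(** The matrices act on row vectors from the right; the inverse turns this into a left action. *)
Definition row_act (g : gT) (v : 'rV[R]_n) : 'rV[R]_n := v *m rG g^-1%g.

Lemma cox_refl_mem t : t \in T -> t \in W.
Proof.
have [genS _ _] := hWS; case/imset2P=> s g sS gW ->.
by rewrite groupJ // -genS mem_gen.
Qed.

(** The reflection [t ^ g] negates the unit vector [rt t *m rG g], which is therefore a multiple of
    the unit normal [rt (t ^ g)]. *)
Lemma normals_conj x0 rt g t : normals S rG x0 rt -> g \in W -> t \in T ->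
  rt t *m rG g = rt (t ^ g)%g \/ rt t *m rG g = - rt (t ^ g)%g.
Proof.
move=> nm gW tT; have tW := cox_refl_mem tT.
have t'T : (t ^ g)%g \in T.
  case/imset2P: tT => s h sS hW ->; rewrite -conjgM.
  by apply/imset2P; exists s (h * g)%g; rewrite ?groupM.
set e := rt t *m rG g; set f := rt (t ^ g)%g; pose d := dotv e f.
have ee : dotv e e = 1 by rewrite (nm_orth nm) // (nm_unit nm).
have ff : dotv f f = 1 by exact: nm_unit nm _ _.
have eN : e *m rG (t ^ g)%g = - e.
  rewrite /e -mulmxA -repr_mxM ?groupJ // -conjgC repr_mxM // mulmxA.
  rewrite (nm_refl nm _ tT) (nm_unit nm) // mulr1 scaler_nat mulr2n opprD addrA.
  by rewrite subrr add0r mulNmx.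
have eE : e = d *: f.
  have := nm_refl nm e t'T; rewrite eN -/f -/d => /eqP.
  rewrite -subr_eq0 opprB addrCA -opprD subr_eq0 -mulr2n -scaler_nat -scalerA => /eqP E.
  by apply: (@scalerI R _ 2%:R); [rewrite pnatr_eq0|rewrite E].
have /eqP : d ^+ 2 = 1 by move: ee; rewrite eE !dotvEE ff mulr1.
rewrite sqrf_eq1 => /orP[/eqP d1|/eqP d1].
- by left; rewrite eE d1 scale1r.
- by right; rewrite eE d1 scaleN1r.
Qed.

Lemma root_datum_exists : reflection_realization S rG C -> exists x0 rt wt,
  [/\ normals S rG x0 rt, {in T &, injective rt}, C = chamber rt T &
      root_datum W S (@dotv R n) row_act rt wt].
Proof.
have [genS ordS _] := hWS; case=> [ff reflS [x0 x0T CE] facets].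
have [rt nm] := exists_normals genS reflS x0T.
have TW : T \subset W by apply/fintype.subsetP; exact: cox_refl_mem.
have inj := nm_inj nm ff TW.
have TT : T \subset T by [].
have CE' : C = chamber rt T by rewrite CE (component_x0 nm TT).
have ss s : s \in S -> (s * s = 1)%g.
  by move=> sS; rewrite -[(s * s)%g]/(s ^+ 2)%g -(ordS s sS) expg_order.
have reflJ t g : t \in T -> g \in W -> (t ^ g)%g \in T.
  case/imset2P=> s h sS hW -> gW; rewrite -conjgM.
  by apply/imset2P; exists s (h * g)%g; rewrite ?groupM.
have tV t : t \in T -> t^-1%g = t.
  case/imset2P=> s h sS hW ->; rewrite -conjVg; congr (_ ^ _)%g.
  by apply: (mulgI s); rewrite mulgV ss.
have conjA t t' : t \in T -> t' \in T -> (t ^ t')%g \in T.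
  by move=> tT t'T; apply: reflJ => //; exact: cox_refl_mem.
have rtA t t' : t \in T -> t' \in T ->
    rt t *m rG t' = rt (t ^ t')%g \/ rt t *m rG t' = - rt (t ^ t')%g.
  by move=> tT t'T; apply: (normals_conj nm) => //; exact: cox_refl_mem.
have [D [wt sys]] := exists_simple_system nm TT conjA rtA.
(* Both sets consist of the reflections whose mirrors define facets of [C]. *)
have DS : D = S.
  apply/setP=> t; have [tT|tnT] := boolP (t \in T).
    apply/idP/idP=> [tD|tS].
      by apply/(facets t tT); rewrite CE'; apply/(simple_system_facet nm TT inj sys tT).
    by apply/(simple_system_facet nm TT inj sys tT); rewrite -CE'; apply/(facets t tT).
  have [/fintype.subsetP DT _ _ _] := sys.
  rewrite (contraNF (DT t) tnT); apply/esym/negbTE; apply: contra tnT => tS.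
  by apply/imset2P; exists t 1%g; rewrite ?conjg1.
rewrite {}DS in sys; have [_ wtP expand ge0] := sys.
exists x0, rt, wt; split=> //; split=> //.
- exact: dotvC.
- exact: dotvDl.
- exact: dotvZl.
- exact: dotv_eq0.
- by move=> g u v; rewrite /row_act mulmxDl.
- by move=> g k v; rewrite /row_act scalemxAl.
- by move=> v; rewrite /row_act invg1 repr_mx1 mulmx1.
- by move=> g h v gW hW; rewrite /row_act invMg repr_mxM ?groupV // mulmxA.
- by move=> g u v gW; rewrite /row_act (nm_orth nm) // groupV.
- exact: nm_unit nm.
- by move=> t v tT; rewrite /row_act tV // (nm_refl nm).
- by move=> g t gW tT; rewrite /row_act; apply: (normals_conj nm); rewrite ?groupV.
Qed.

(** * Canonical generators of a parabolic subgroup *)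

Section CanonicalGenerators.

Variables (x0 : 'rV[R]_n) (rt : gT -> 'rV[R]_n).
Hypothesis nm : normals S rG x0 rt.
Hypothesis inj : {in T &, injective rt}.
Hypothesis CE : C = chamber rt T.
Variable P : {group gT}.

(** A region of the subarrangement containing [C] contains [x0], so it is the chamber, whose facets
    belong to the simple system. *)
Lemma canonical_simple_system :
  exists wt, simple_system rt (T :&: P) (canonical_generators S rG C P) wt.
Proof.
have AT : T :&: P \subset T by exact: subsetIl.
have mem t : t \in T :&: P -> t \in T by exact: (fintype.subsetP AT).
have conjA t t' : t \in T :&: P -> t' \in T :&: P -> (t ^ t')%g \in T :&: P.
  rewrite !inE => /andP[tT tP] /andP[t'T t'P]; rewrite groupJ // andbT.
  case/imset2P: tT => s h sS hW ->; rewrite -conjgM.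
  by apply/imset2P; exists s (h * t')%g; rewrite ?groupM // cox_refl_mem.
have rtA t t' : t \in T :&: P -> t' \in T :&: P ->
    rt t *m rG t' = rt (t ^ t')%g \/ rt t *m rG t' = - rt (t ^ t')%g.
  by move=> /mem tT /mem t'T; apply: (normals_conj nm) => //; exact: cox_refl_mem.
have injA : {in T :&: P &, injective rt}.
  by move=> t t' /mem tT /mem t'T; exact: inj.
have [D [wt sys]] := exists_simple_system nm AT conjA rtA.
suff -> : canonical_generators S rG C P = D by exists wt.
have [/fintype.subsetP DA _ _ _] := sys.
apply/setP=> t; rewrite inE; apply/andP/idP=> [[tA /asboolP[K [regK CK fK]]]|tD].
  apply/(simple_system_facet nm AT injA sys tA).
  rewrite -(region_x0 nm AT regK) //; apply: CK; rewrite CE.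
  exact: (chamber_x0 nm).
have tA := DA _ tD; split=> //; apply/asboolP; exists (chamber rt (T :&: P)); split.
- exact: (region_chamber nm AT).
- by rewrite CE => v vT t' /mem t'T; exact: vT.
- exact/(simple_system_facet nm AT injA sys tA).
Qed.

Lemma canonical_generatorsP t1 t2 : irr_rank2_parabolic W S P ->
  canonical_generators S rG C P = [set t1; t2] <->
  cone_generators rt (T :&: P) t1 t2.
Proof.
have AT : T :&: P \subset T by exact: subsetIl.
have [wt sys] := canonical_simple_system.
move=> [[J [g gW [JS J2 PE]]] _]; split; last exact: (cone_generators_system nm inj AT sys).
(* With [t1 = t2] the simple system would be a single reflection and hence all of [T :&: P], which
   contains conjugates of two distinct generators. *)
move=> cE; apply: (simple_system_pair sys) => //; apply/eqP=> t12.
move/eqP: J2 => /cards2P[r1 [r2 [r12 JE]]].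
have inA r : r \in J -> (r ^ g)%g \in T :&: P.
  move=> rJ; rewrite inE; apply/andP; split.
    by apply/imset2P; exists r g => //; exact: (fintype.subsetP JS).
  by rewrite -[_ \in P]/(_ \in (P : {set gT})) PE memJ_conjg mem_gen.
have eq1 t : t \in T :&: P -> t = t1.
  move=> tA; apply: (simple_system_supp nm inj AT sys) => //.
    by rewrite cE !inE eqxx.
  by move=> e; rewrite cE !inE -t12 orbb => ->.
have E1 := eq1 _ (inA r1 _); have E2 := eq1 _ (inA r2 _).
by case/eqP: r12; apply: (conjg_inj g); rewrite E1 ?E2 // JE !inE eqxx ?orbT.
Qed.

Lemma cone_generators_exist t1 t2 : t1 \in T :&: P -> t2 \in T :&: P -> t1 != t2 ->
  (forall t, t \in T :&: P -> in_plane rt t1 t2 t) ->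
  exists d1 d2, cone_generators rt (T :&: P) d1 d2.
Proof.
have [wt sys] := canonical_simple_system.
exact: (plane_simple_system nm inj (subsetIl _ _) sys).
Qed.

End CanonicalGenerators.

End Realization.

Theorem theorem4p1 (R : realType) (gT : finGroupType) (W : {group gT})
    (S : {set gT}) (hWS : coxeter_system W S)
    (n : nat) (rG : mx_representation R W n) (C : set 'rV[R]_n)
    (hC : reflection_realization S rG C)
    (o : gT -> rel gT) (ho : c_orientation_family S rG C o)
    (c : gT) (hc : coxeter_element S c)
    (a : seq gT) (ha : reduced_word S c a)
    (w : gT) (hw : w \in W) :
  sortable S a w <-> aligned S rG C (o c) w.
Proof.
have [x0 [rt [wt [nm inj CE rd]]]] := root_datum_exists hWS hC.
have [ho1 ho2] := ho.
have aS := coxeter_word_perm rd hc ha.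
have word b : perm_eq b (enum S) -> reduced_word S (\prod_(r <- b) r)%g b.
  move=> bS; apply: (uniq_reduced_word rd); last by rewrite (perm_uniq bS) enum_uniq.
  by move=> r; rewrite (perm_mem bS) mem_enum.
have cox b : perm_eq b (enum S) -> coxeter_element S (\prod_(r <- b) r)%g.
  by move=> bS; exists b => //; exact: word.
have canP P t1 t2 := canonical_generatorsP hWS nm inj CE t1 t2 (P := P).
(* The axioms speak of Coxeter elements; every permutation of [S] is a reduced word of one, so they
   can be restated for words. *)
have o_first s b (P : {group gT}) t : perm_eq (s :: b) (enum S) ->
    irr_rank2_parabolic W S P -> cone_generators rt (reflections W S :&: P) s t ->
    o (\prod_(r <- s :: b) r)%g s t.
  move=> sbS irrP cone.
  have [|first _] := ho2 _ s (cox _ sbS); first by exists b; exact: word.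
  by apply: (first P t irrP); exact/canP.
have o_rot s b t1 t2 : perm_eq (s :: b) (enum S) ->
    o (\prod_(r <- s :: b) r)%g t1 t2 ->
    o (\prod_(r <- rcons b s) r)%g (t1 ^ s)%g (t2 ^ s)%g.
  move=> sbS o12; have sS := first_simple sbS.
  have [|_ rot] := ho2 _ s (cox _ sbS); first by exists b; exact: word.
  (* Conjugation by the first letter moves it to the end of the word. *)
  have := rot _ _ o12; rewrite -!(conjg_simple rd _ sS).
  by rewrite big_cons conjgE -mulgA mulKg -cats1 big_cat big_cons big_nil /= mulg1.
have oP (P : {group gT}) t1 t2 : irr_rank2_parabolic W S P ->
    cone_generators rt (reflections W S :&: P) t1 t2 ->
    o c t1 t2 <-> (0 < om (@dotv R n) rt wt a (rt t1) (rt t2))%R.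
  move=> irrP cone; rewrite -(reduced_word_prod ha); split=> [o12|].
    have [arrows cycles] := ho1 _ (cox _ aS).
    have [_ _ _ ncom] := arrows _ _ o12.
    exact: (arrow_om rd o_first o_rot aS irrP cone (cycles P irrP) ncom o12).
  exact: (om_arrow rd o_first o_rot aS irrP cone).
rewrite (sortable_form_aligned rd aS hw).
have inter : form_aligned W S (@dotv R n) (row_act rG) rt wt a w <->
    generator_aligned W S (@dotv R n) (row_act rG) rt wt (o c) w.
  split; first exact: (form_generator_aligned rd oP).
  apply: (generator_form_aligned rd oP _ hw) => P t1 t2.
  exact: (cone_generators_exist hWS nm inj CE).
rewrite inter; split=> al P t1 t2 irrP.
  move=> /(canP _ _ _ irrP) cone o12; have [+ + _ _] := cone.
  move=> /finset.setIP[t1T _] /finset.setIP[t2T _].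
  rewrite !(inversionsE rd) // t1T /= => /andP[_].
  rewrite -{1}(reflV rd t2T) -mulgA -conjgE; exact: al cone o12.
move=> cone o12; have [+ + _ _] := cone.
move=> /finset.setIP[t1T _] /finset.setIP[t2T _] wt12.
have := al P t1 t2 irrP ((canP _ _ _ irrP).2 cone) o12.
rewrite !(inversionsE rd) // t1T /=; apply.
have -> : (t2 * t1 * t2 = t1 ^ t2)%g by rewrite conjgE (reflV rd t2T) mulgA.
rewrite wt12 andbT.
by apply: (reflJ t1T); exact: refl_mem rd _ t2T.
Qed.
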